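(* Consider the model $\mathrm{BOHT}(q,r,\pi,B,D)$ where $D$ is a distribution on $\mathbb{Z}_{\ge 0}$ with mean $\mathbb{E}_{t\sim D}t=d$. (i) If $(r-1)\,d\,\eta^{(m)}_{\mathrm{KL}}(\pi,B)<1$, or if both $(r-1)\,d\,\eta^{(m)}_{\mathrm{SKL}}(\pi,B)<1$ and $I_{\mathrm{SKL}}(\pi,B)<\infty$, then reconstruction is impossible. (ii) Suppose the model is binary symmetric. If $(r-1)\,d\,\eta^{(m,s)}_{\mathrm{KL}}(B)<1$, or $(r-1)\,d\,\eta^{(m,s)}_{\chi^2}(B)<1$, or both $(r-1)\,d\,\eta^{(m,s)}_{\mathrm{SKL}}(B)<1$ and $C_{\mathrm{SKL}}(B)<\infty$, then reconstruction is impossible.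
   Context: Let $q\ge 2$, $r\ge 2$ be integers, $\pi$ a distribution on $[q]$ with full support, and $B:[q]\to[q]^{r-1}$ a probability kernel satisfying $\sum_{k\in[q]}\pi_k\sum_{x\in[q]^{r-1},\,x_i=j}B(x|k)=\pi_j$ for all $i\in[r-1]$, $j\in[q]$. For an $r$-uniform linear hypertree $T$ rooted at $\rho$ (every non-root vertex lies in exactly one hyperedge with its parent; each vertex $u$ has a set of ''downward'' hyperedges $\{u,v_1,\dots,v_{r-1}\}$ whose other vertices are its children), the broadcasting model $\mathrm{BOHT}(T,q,r,\pi,B)$ assigns labels $\sigma_u\in[q]$: $\sigma_\rho\sim\pi$, and given $\sigma_u$, for each downward hyperedge $\{u,v_1,\dots,v_{r-1}\}$ independently, $\mathbb{P}[\sigma_{v_i}=x_i\ \forall i\mid\sigma_u=y]=B(x_1,\dots,x_{r-1}|y)$. $\mathrm{BOHT}(q,r,\pi,B,D)$ is the same model where $T$ is a Galton–Watson hypertree in which every vertex independently has $t\sim D$ downward hyperedges. Let $T_k$ be the set of vertices at distance $\le k$ from $\rho$ and $L_k$ those at distance exactly $k$. Reconstruction is impossible if $\lim_{k\to\infty}I(\sigma_\rho;T_k,\sigma_{L_k})=0$ and possible otherwise. For an $f$-divergence, $\pi\in\mathcal P(\mathcal X)$ and channel $P:\mathcal X\to\mathcal Y$, $I_f(\pi,P)$ denotes the $f$-information $I_f(X;Y)=D_f(P_{XY}\|P_X\otimes P_Y)$ with $X\sim\pi$, $Y\mid X\sim P$. KL: $f(x)=x\log x$ (giving mutual information $I$);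 $\chi^2$: $f(x)=(x-1)^2$; SKL: $f(x)=(x-1)\log x$. For channels $P$, $P^{\times n}$ denotes the $n$-fold tensor power (acting independently on $n$ inputs). The multi-terminal contraction coefficient is $\eta^{(m)}_f(\pi,B)=\sup_P \frac{I_f(\pi,P^{\times(r-1)}\circ B)}{(r-1)I_f(\pi,P)}$, supremum over channels $P$ with input alphabet $[q]$ and $0<I_f(\pi,P)<\infty$. A channel $P:\{\pm\}\to\mathcal Y$ is BMS (binary memoryless symmetric) if there is a measurable involution $\sigma$ of $\mathcal Y$ with $P(E|+)=P(\sigma(E)|-)$ for all measurable $E$. The model is binary symmetric if $q=2$ (alphabet $\{\pm\}$), $\pi=\mathrm{Unif}(\{\pm\})$, and $B$ together with the coordinatewise sign flip on $\{\pm\}^{r-1}$ is a BMS channel. For BMS $P$, $C_f(P):=I_f(\mathrm{Unif}(\{\pm\}),P)$, and $\eta^{(m,s)}_f(B)=\sup_P\frac{C_f(P^{\times(r-1)}\circ B)}{(r-1)C_f(P)}$, supremum over BMS channels $P$ with $0<C_f(P)<\infty$. *)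

(* Defs.v *)
From HB Require Import structures.
From mathcomp Require Import all_boot all_order all_algebra.
From mathcomp Require Import all_classical all_reals all_analysis.
Set Implicit Arguments. Unset Strict Implicit. Unset Printing Implicit Defensive.
Import Order.TTheory GRing.Theory Num.Theory.
Local Open Scope ring_scope.
Local Open Scope classical_set_scope.

Section Defs.
Variable R : realType.
Local Open Scope ereal_scope.

(* ---------- f-divergence generators (normalized so that f >= 0, f(1)=0) --
   f_KL(t) = t ln t - (t - 1),  f_chi2(t) = (t-1)^2,  f_SKL(t) = (t-1) ln t.
   Adding a multiple of (t-1) does not change D_f(P||Q) when P << Q, which
   is always the case for P_XY vs P_X (x) P_Y with pi of full support.      *)
Definition fKL (t : R) : \bar R :=
  if t == 0%R then 1 else (t * ln t - t + 1)%:E.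
Definition fchi2 (t : R) : \bar R := ((t - 1) ^+ 2)%:E.
Definition fSKL (t : R) : \bar R :=
  if t == 0%R then +oo else ((t - 1) * ln t)%:E.

Definition persp (f : R -> \bar R) (a b : R) : \bar R :=
  if (0 < b)%R then b%:E * f (a / b)%R else 0.

(* f-information I_f(pi, W) for a channel W : [q] -> T with countable
   (discrete) output alphabet T, given as a family of pmfs W k : T -> R. *)
Definition dinfo (q : nat) (T : choiceType) (f : R -> \bar R)
  (pi : 'I_q -> R) (W : 'I_q -> T -> R) : \bar R :=
  \esum_(o in [set: T])
     \sum_(k < q) (pi k)%:E * persp f (W k o) (\sum_(j < q) pi j * W j o)%R.

(* ---------- general channels [q] -> Y ------------------------------------
   A channel with input [q] and output a measurable space Y is given by a
   reference probability measure mu on Y and densities p k (k in [q]) of the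
   output laws P(.|k) with respect to mu. *)
Definition is_channel (q : nat) d (Y : measurableType d)
  (mu : probability Y R) (p : 'I_q -> Y -> R) : Prop :=
  (forall k, measurable_fun setT (p k)) /\
  (forall k y, (0 <= p k y)%R) /\
  (forall k, \int[mu]_y (p k y)%:E = 1).

Definition cinfo (q : nat) d (Y : measurableType d) (f : R -> \bar R)
  (pi : 'I_q -> R) (mu : probability Y R) (p : 'I_q -> Y -> R) : \bar R :=
  \sum_(k < q) (pi k)%:E *
     \int[mu]_y persp f (p k y) (\sum_(j < q) pi j * p j y)%R.

(* integral over Y^n against the product measure mu^{(x) n}, written as an
   iterated integral (Tonelli) over the list of outputs (y_1, ..., y_n) *)
Fixpoint iint d (Y : measurableType d) (mu : probability Y R) (n : nat)
  (g : seq Y -> \bar R) : \bar R :=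
  match n with
  | 0 => g [::]
  | n'.+1 => \int[mu]_y iint mu n' (fun ys => g (y :: ys))
  end.

(* density (w.r.t. mu^{(x)(r-1)}) of the composed channel P^{x(r-1)} o B
   at input k and output ys = (y_1,...,y_{r-1}):
      sum_x B(x|k) prod_i p_{x_i}(y_i) *)
Definition compdens (q r : nat) (B : 'I_q -> (r.-1).-tuple 'I_q -> R)
  (Y : Type) (p : 'I_q -> Y -> R) (k : 'I_q) (ys : seq Y) : R :=
  (\sum_(x : (r.-1).-tuple 'I_q)
      B k x * \prod_(ij <- zip (val x) ys) p ij.1 ij.2)%R.

Definition cinfo_comp (q r : nat) d (Y : measurableType d) (f : R -> \bar R)
  (pi : 'I_q -> R) (B : 'I_q -> (r.-1).-tuple 'I_q -> R)
  (mu : probability Y R) (p : 'I_q -> Y -> R) : \bar R :=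
  \sum_(k < q) (pi k)%:E *
     iint mu r.-1 (fun ys => persp f (compdens B p k ys)
                       (\sum_(j < q) pi j * compdens B p j ys)%R).

Definition eta_m (q r : nat) (f : R -> \bar R) (pi : 'I_q -> R)
  (B : 'I_q -> (r.-1).-tuple 'I_q -> R) : \bar R :=
  ereal_sup [set v | exists (d : measure_display) (Y : measurableType d)
     (mu : probability Y R) (p : 'I_q -> Y -> R),
     [/\ is_channel mu p, 0 < cinfo f pi mu p, cinfo f pi mu p < +oo &
         v = cinfo_comp f pi B mu p
             * (((r.-1)%:R * fine (cinfo f pi mu p))^-1)%:E]].

Definition flip2 (k : 'I_2) : 'I_2 := rev_ord k.

Definition is_BMS d (Y : measurableType d) (mu : probability Y R)
  (p : 'I_2 -> Y -> R) : Prop :=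
  exists s : Y -> Y, [/\ measurable_fun setT s, (forall y, s (s y) = y) &
    forall (k : 'I_2) (E : set Y), measurable E ->
      \int[mu]_(y in E) (p k y)%:E = \int[mu]_(y in s @` E) (p (flip2 k) y)%:E].

Definition unif2 : 'I_2 -> R := fun _ => (2%:R)^-1%R.

Definition eta_ms (r : nat) (f : R -> \bar R)
  (B : 'I_2 -> (r.-1).-tuple 'I_2 -> R) : \bar R :=
  ereal_sup [set v | exists (d : measure_display) (Y : measurableType d)
     (mu : probability Y R) (p : 'I_2 -> Y -> R),
     [/\ is_channel mu p, is_BMS mu p, 0 < cinfo f unif2 mu p,
         cinfo f unif2 mu p < +oo &
         v = cinfo_comp f unif2 B mu p
             * (((r.-1)%:R * fine (cinfo f unif2 mu p))^-1)%:E]].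

Definition is_B (q r : nat) (pi : 'I_q -> R)
  (B : 'I_q -> (r.-1).-tuple 'I_q -> R) : Prop :=
  [/\ (forall k x, (0 <= B k x)%R),
      (forall k, (\sum_(x : (r.-1).-tuple 'I_q) B k x)%R = 1%R) &
      (forall (i : 'I_(r.-1)) (j : 'I_q),
         (\sum_(k < q) pi k *
            \sum_(x : (r.-1).-tuple 'I_q | tnth x i == j) B k x)%R = pi j)].

Definition is_pi (q : nat) (pi : 'I_q -> R) : Prop :=
  (forall k, (0 < pi k)%R) /\ (\sum_(k < q) pi k)%R = 1%R.

Definition is_offspring (D : nat -> R) (dm : R) : Prop :=
  [/\ (forall t, (0 <= D t)%R),
      \sum_(t <oo) (D t)%:E = 1 &
      \sum_(t <oo) ((t%:R * D t)%R)%:E = dm%:E].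

Definition is_binary_symmetric (r : nat) (pi : 'I_2 -> R)
  (B : 'I_2 -> (r.-1).-tuple 'I_2 -> R) : Prop :=
  (forall k, pi k = (2%:R)^-1%R) /\
  (forall k x, B k x = B (flip2 k) (map_tuple flip2 x)).

End Defs.

(* ---------- observations (T_k, sigma_{L_k}) of the GW hypertree -----------
   obsT q r k : an (ordered) Galton-Watson hypertree of depth k, where every
   vertex at depth < k carries its list of downward hyperedges, each being an
   ordered (r-1)-tuple of children, and each vertex at depth k carries its
   label in [q]. *)
Fixpoint obsT (q r k : nat) : choiceType :=
  match k with
  | 0 => Choice.clone _ 'I_q
  | k'.+1 => Choice.clone _ (seq ((r.-1).-tuple (obsT q r k')))
  end.

Section Model.
Variable R : realType.

(* P[(T_k, sigma_{L_k}) = o | sigma_rho = y] in BOHT(q, r, pi, B, D) *)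
Fixpoint obsP (q r : nat) (B : 'I_q -> (r.-1).-tuple 'I_q -> R)
  (D : nat -> R) (k : nat) {struct k} : obsT q r k -> 'I_q -> R :=
  match k as k0 return obsT q r k0 -> 'I_q -> R with
  | 0 => fun (o : 'I_q) y => (o == y)%:R
  | k'.+1 => fun (es : seq ((r.-1).-tuple (obsT q r k'))) y =>
      D (size es) *
      \prod_(e <- es) \sum_(x : (r.-1).-tuple 'I_q)
          B y x * \prod_(i < r.-1) @obsP q r B D k' (tnth e i) (tnth x i)
  end.

Definition MI_k (q r : nat) (pi : 'I_q -> R)
  (B : 'I_q -> (r.-1).-tuple 'I_q -> R) (D : nat -> R) (k : nat) : \bar R :=
  dinfo (@fKL R) pi (fun y (o : obsT q r k) => obsP B D o y).

Definition reconstruction_impossible (q r : nat) (pi : 'I_q -> R)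
  (B : 'I_q -> (r.-1).-tuple 'I_q -> R) (D : nat -> R) : Prop :=
  MI_k pi B D k @[k --> \oo] --> 0%E.

End Model.

(* Main.v *)
Require Import Defs.
From HB Require Import structures.
From mathcomp Require Import all_boot all_order all_algebra.
From mathcomp Require Import all_classical all_reals all_analysis.
From mathcomp Require Import lra ring.
Import Order.TTheory GRing.Theory Num.Theory.
Local Open Scope ring_scope.
Set Implicit Arguments. Unset Strict Implicit. Unset Printing Implicit Defensive.

(* Let P_k be the channel from the root label to the depth-k observation and
   E_k := P_k^(x)(r-1) o B the observation carried by one downward hyperedge of
   a vertex whose children are observed through P_k.  P_(k+1) is the mixture
   over t ~ D of t-fold products of E_k with itself, so subadditivity of I_f
   over conditionally independent observations gives
   I_f(P_(k+1)) <= d I_f(E_k) <= (r-1) d eta_f I_f(P_k): the f-information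
   decays geometrically from the first depth at which it is finite, and it
   dominates mutual information since f_KL <= f_chi2 and f_KL <= f_SKL
   pointwise.  For chi^2 subadditivity uses the label-flip symmetry, under
   which every P_k is a BMS channel.  *)

(** * Sums of nonnegative families *)

(** The observations live on countable alphabets, whereas the suprema defining [eta] range over
    channels given by densities on measurable spaces. The bridge is to take the output law of the
    channel under [pi] as reference measure: full support makes it dominate every conditional law,
    and homogeneity of the perspective turns the integrals back into sums. Subadditivity cannot be
    read off a chain rule, because that subtracts quantities that may be infinite. For KL and SKL it
    is checked at one pair of outputs at a time, between nonnegative terms, after adding to the two
    sides families of equal total mass: the product of the marginals on the left, the joint law of
    the pair on the right. Apart from subadditivity, a generator [f] enters only through [f 1 = 0]
    and [fKL t <= f t]. The latter makes [f] nonnegative, lets it vanish only at 1, so that zero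
    information forces a channel that ignores its input, and gives the comparison with mutual
    information. *)

Section Esum.
Context {R : realType}.
Local Open Scope ereal_scope.
Local Open Scope classical_set_scope.

(** Distributing over finite partial sums gives one inequality for every scalar; for finite nonzero
    [x] the other is the same inequality applied to the inverse. The value [+oo] is allowed because
    the scalar will be an f-information. *)
Lemma esumZl (T : choiceType) (x : \bar R) (a : T -> \bar R) :
  0 <= x -> (forall i, 0 <= a i) ->
  \esum_(i in [set: T]) (x * a i) = x * \esum_(i in [set: T]) a i.
Proof.
move=> x0 a0.
have le (y : \bar R) (b : T -> \bar R) : 0 <= y -> (forall i, 0 <= b i) ->
    \esum_(i in [set: T]) (y * b i) <= y * \esum_(i in [set: T]) b i.
  move=> y0 b0; apply: ge_ereal_sup => _ [X [finX _]] <-.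
  rewrite fsbig_finite//= -ge0_sume_distrr// lee_pmul//.
    by apply: sume_ge0.
  rewrite esum_ge//; exists X => //=.
  by rewrite fsbig_finite.
apply/eqP; rewrite eq_le le//=.
have [->|xn0] := eqVneq x 0; first by rewrite mul0e esum_ge0// => i _; rewrite mul0e.
case: x x0 xn0 => [x||]//= x0 xn0.
  have xp : (0 < x)%R by rewrite lt_neqAle eq_sym -eqe xn0 -lee_fin.
  rewrite -lee_pdivlMl// (le_trans _ (le _ _ _ _))//.
  - by apply: le_esum => i _; rewrite muleA -EFinM mulVf ?mul1e// gt_eqF.
  - by rewrite lee_fin invr_ge0 ltW.
  - by move=> i; rewrite mule_ge0.
have [[i ai]|/forallNP na] := pselect (exists i, 0 < a i).
  rewrite [leRHS](_ : _ = +oo) ?leey//; apply/eqP; rewrite -leye_eq.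
  apply: esum_ge; exists [set i] => //=.
  by rewrite fsbig_set1 gt0_mulye.
by rewrite esum1 ?mule0 ?esum_ge0//= => [i _|i _]; last first;
  (suff -> : a i = 0 by rewrite ?mule0);
  apply/eqP; rewrite eq_le a0 andbT leNgt; apply/negP/na.
Qed.

Lemma esum_pair (T1 T2 : choiceType) (a : T1 -> T2 -> \bar R) :
  (forall i j, 0 <= a i j) ->
  \esum_(p in [set: T1 * T2]) a p.1 p.2 =
  \esum_(i in [set: T1]) \esum_(j in [set: T2]) a i j.
Proof.
move=> a0; rewrite esum_esum//; congr (esum _ _).
by apply/seteqP; split.
Qed.

Lemma esum_pairC (T1 T2 : choiceType) (a : T1 -> T2 -> \bar R) :
  (forall i j, 0 <= a i j) ->
  \esum_(p in [set: T1 * T2]) a p.1 p.2 =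
  \esum_(j in [set: T2]) \esum_(i in [set: T1]) a i j.
Proof.
move=> a0; rewrite -(@esum_pair _ _ (fun j i => a i j))//.
rewrite (@reindex_esum _ _ _ setT setT (fun p : T2 * T1 => (p.2, p.1)))//.
by split => //= [[a1 a2] [b1 b2] _ _ [-> ->]//|[p1 p2] _]; exists (p2, p1).
Qed.

Lemma esum_finType (T : finType) (a : T -> \bar R) : (forall i, 0 <= a i) ->
  \esum_(i in [set: T]) a i = \sum_i a i.
Proof.
move=> a0.
rewrite esum_fset//; last exact: finite_finset.
rewrite (fsbig_finite _ _ finite_finset)/=.
rewrite -[RHS]big_enum/=; apply: perm_big; apply: uniq_perm; rewrite ?enum_uniq ?finmap.fset_uniq//.
by move=> x; rewrite (in_fset_set finite_finset) mem_enum in_setT.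
Qed.

Lemma esum_tuple0 (T : choiceType) (a : 0.-tuple T -> \bar R) : 0 <= a [tuple] ->
  \esum_(t in [set: 0.-tuple T]) a t = a [tuple].
Proof.
move=> a0; rewrite (_ : setT = [set [tuple]]) ?esum_set1//.
by apply/seteqP; split => x //= _; rewrite tuple0.
Qed.

Lemma esum_tupleS (T : choiceType) n (a : n.+1.-tuple T -> \bar R) :
  (forall t, 0 <= a t) ->
  \esum_(t in [set: n.+1.-tuple T]) a t =
  \esum_(o in [set: T]) \esum_(t in [set: n.-tuple T]) a (cons_tuple o t).
Proof.
move=> a0; rewrite -(@esum_pair _ _ (fun o t => a (cons_tuple o t)))//.
rewrite (@reindex_esum _ _ _ setT setT (fun p : T * n.-tuple T => cons_tuple p.1 p.2))//.
split => //= [[a1 a2] [b1 b2] _ _ /(congr1 val)/= [-> /val_inj ->]//|t _].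
by exists (thead t, behead_tuple t) => //=; rewrite [RHS]tuple_eta; apply: val_inj.
Qed.

Lemma esum_seq (T : choiceType) (a : seq T -> \bar R) : (forall s, 0 <= a s) ->
  \esum_(s in [set: seq T]) a s = \sum_(n <oo) \esum_(t in [set: n.-tuple T]) a t.
Proof.
move=> a0; rewrite nneseries_esumT; last by move=> n; exact: esum_ge0.
under [RHS]eq_esum => n _.
  rewrite -(@reindex_esum _ _ _ _ [set s : seq T | size s = n] val a); last first.
    split => [t _ /=|? ? _ _ /val_inj//|s /= /eqP sn]; first by rewrite size_tuple.
    by exists (Tuple sn).
  over.
rewrite /= esum_esum//.
rewrite [RHS](@reindex_esum _ (seq T) _ setT _ (fun s => (size s, s)))//.
by split => //= [s1 s2 _ _ [_ ->]//|[n s] /= [_ <-]]; exists s.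
Qed.

Lemma esum_tuple_prod1 (T : choiceType) n (h : 'I_n -> T -> R) :
  (forall i o, (0 <= h i o)%R) ->
  (forall i, \esum_(o in [set: T]) (h i o)%:E = 1) ->
  \esum_(t in [set: n.-tuple T]) (\prod_(i < n) h i (tnth t i))%:E = 1.
Proof.
elim: n h => [|n IH] h h0 h1; first by rewrite esum_tuple0 big_ord0.
rewrite esum_tupleS; last by move=> t; rewrite lee_fin prodr_ge0.
rewrite -[RHS](h1 ord0); apply: eq_esum => o _.
transitivity (\esum_(t in [set: n.-tuple T])
    (h ord0 o)%:E * (\prod_(i < n) h (lift ord0 i) (tnth t i))%:E).
  apply: eq_esum => t _; rewrite big_ord_recl/= -EFinM tnth0.
  by congr (_ * _)%:E%R; apply: eq_bigr => i _; rewrite tnthS.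
rewrite esumZl ?lee_fin// => [|t]; last by rewrite lee_fin prodr_ge0.
by rewrite (IH (fun i => h (lift ord0 i)))// mule1.
Qed.

End Esum.

(** * Discrete measurable spaces *)

(* The discrete sigma-algebra; the base point is a parameter because a
   [measurableType] must be pointed. *)
Definition disc (T : choiceType) (x0 : T) : Type := T.

HB.instance Definition _ (T : choiceType) (x0 : T) := Choice.on (disc x0).
HB.instance Definition _ (T : choiceType) (x0 : T) :=
  isPointed.Build (disc x0) x0.
HB.instance Definition _ (T : choiceType) (x0 : T) :=
  @isMeasurable.Build default_measure_display (disc x0)
    (@discrete_measurable (disc x0)) (@discrete_measurable0 _)
    (@discrete_measurableC _) (@discrete_measurableU _).

Section DiscreteMeasure.
Context {R : realType} (T : choiceType) (x0 : T).
Local Open Scope ereal_scope.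
Local Open Scope classical_set_scope.

Lemma disc_measurable (E : set (disc x0)) : measurable E.
Proof. by []. Qed.

Lemma disc_measurable_fun d (Y : measurableType d) D (g : disc x0 -> Y) :
  measurable_fun D g.
Proof. by move=> mD E mE; exact: disc_measurable. Qed.

(** The measure is a series of weighted point masses indexed by [nat], which is where countability,
    in the form of the injection [f], is needed. *)
Lemma disc_probability (f : T -> nat) (w : T -> R) :
  injective f -> (forall o, 0 <= w o)%R ->
  \esum_(o in [set: T]) (w o)%:E = 1 ->
  exists mu : probability (disc x0) R,
    forall g : T -> \bar R, (forall o, 0 <= g o) ->
      \int[mu]_(y in setT) g y = \esum_(o in [set: T]) (w o)%:E * g o.
Proof.
move=> finj w0 w1.
pose e n : disc x0 := xget x0 [set o | f o = n].
have ef o : e (f o) = o.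
  by apply: finj; apply: (@xgetPex _ x0 [set o' | f o' = f o]); exists o.
(* Off the range of [f], [e n] is the default point [x0]; the zero weight keeps it from being
   counted again. *)
pose v n : R := if f (e n) == n then w (e n) else 0%R.
have v0 n : (0 <= v n)%R by rewrite /v; case: ifP.
pose m n := mscale (NngNum (v0 n)) (\d_(e n)) : {measure set (disc x0) -> \bar R}.
pose mu := mseries m 0 : {measure set (disc x0) -> \bar R}.
have intE (g : T -> \bar R) : (forall o, 0 <= g o) ->
    \int[mu]_(y in setT) g y = \esum_(o in [set: T]) (w o)%:E * g o.
  move=> g0; rewrite ge0_integral_measure_series//.
  transitivity (\sum_(n <oo) (v n)%:E * g (e n)).
    apply: eq_eseriesr => n _; rewrite ge0_integral_mscale//.
    by rewrite integral_dirac// diracT mul1e.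
  rewrite nneseries_esumT; last by move=> n; rewrite mule_ge0 ?lee_fin.
  rewrite -[RHS](_ : \esum_(o in [set: T]) ((v (f o))%:E * g (e (f o))) = _); last first.
    by apply: eq_esum => o _; rewrite /v ef eqxx.
  rewrite -(@esum_image _ _ _ setT f (fun n => (v n)%:E * g (e n))); last first.
    by move=> x y _ _; exact: finj.
  rewrite [RHS]esum_mkcond; apply: eq_esum => n _; case: ifPn => //.
  rewrite notin_setE /= => nf; rewrite /v; case: eqP => [fen|]; rewrite ?mul0e//.
  by case: nf; exists (e n).
have mu1 : mu setT = 1.
  rewrite -[LHS]mul1e -integral_cst//= intE//.
  by under eq_esum do rewrite mule1.
pose P := Measure_isProbability.Build _ _ _ mu mu1.
pose muP : probability (disc x0) R := HB.pack (Measure.sort mu) P.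
by exists muP.
Qed.

End DiscreteMeasure.

(** * The divergences at a single output *)

Section KL.
Context {R : realType}.

(** The perspective of [fKL], but real-valued. The linear part makes each term nonnegative and
    cancels when both families have the same total. *)
Definition kl (x y : R) : R := x * ln (x / y) - x + y.

Lemma kl0l (y : R) : kl 0 y = y.
Proof. by rewrite /kl !mul0r subr0 add0r. Qed.

(** The equality case is what makes [fKL] vanish only at 1. *)
Lemma leif_ln (x : R) : 0 < x -> ln x <= x - 1 ?= iff (x == 1).
Proof.
move=> x0; split.
  by have := @le_ln1Dx R (x - 1); rewrite [1 + _]addrC subrK; apply; lra.
apply/eqP/eqP => [lnx|->]; last by rewrite ln1 subrr.
apply/eqP/negPn/negP => x1.
have : ln x != 0 by rewrite ln_eq0.
move=> /expR_gt1Dx; rewrite lnK ?posrE// lnx.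
lra.
Qed.

Lemma kl_ge0 (x y : R) : 0 <= x -> 0 <= y -> (y = 0 -> x = 0) -> 0 <= kl x y.
Proof.
rewrite [0 <= x]le_eqVlt => /predU1P[<-|x0]; first by rewrite kl0l.
rewrite [0 <= y]le_eqVlt => /predU1P[<-|y0 _]; first by move=> /(_ erefl) ->; rewrite kl0l.
have := leif_ln (divr_gt0 y0 x0) => -[+ _].
rewrite -(ler_pM2l x0) mulrBr mulrCA divff ?gt_eqF// !mulr1.
by rewrite /kl -invf_div lnV ?posrE ?divr_gt0// mulrN; lra.
Qed.

Lemma fKL_kl (t : R) : fKL t = (kl t 1)%:E.
Proof.
rewrite /fKL; case: eqVneq => [->|t0]; first by rewrite kl0l.
by rewrite /kl divr1.
Qed.

Lemma fKL_ge0 (t : R) : 0 <= t -> (0 <= fKL t)%E.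
Proof. by move=> t0; rewrite fKL_kl lee_fin kl_ge0// => /eqP; rewrite oner_eq0. Qed.

Lemma fKL_eq0 (t : R) : 0 <= t -> fKL t = 0%E -> t = 1.
Proof.
rewrite le_eqVlt fKL_kl => /predU1P[<-|t0] [].
  by rewrite kl0l => /eqP; rewrite oner_eq0.
rewrite /kl divr1 => klt.
have ti : 0 < t^-1 by rewrite invr_gt0.
have [_ /esym] := leif_ln ti.
have -> : ln t^-1 == t^-1 - 1.
  rewrite lnV ?posrE// -(inj_eq (mulfI (lt0r_neq0 t0))) mulrBr (divff (lt0r_neq0 t0)).
  by apply/eqP; lra.
by move=> /eqP /(congr1 GRing.inv); rewrite invrK invr1.
Qed.

(** Multiply [ln t <= t - 1] by [t]. *)
Lemma fKL_le_fchi2 (t : R) : 0 <= t -> (fKL t <= fchi2 t)%E.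
Proof.
rewrite fKL_kl lee_fin le_eqVlt => /predU1P[<-|t0]; first by rewrite kl0l; lra.
have [lnt _] := leif_ln t0.
have := ler_wpM2l (ltW t0) lnt.
by rewrite /kl divr1 expr2; lra.
Qed.

Lemma fKL_le_fSKL (t : R) : 0 <= t -> (fKL t <= fSKL t)%E.
Proof.
rewrite /fSKL fKL_kl le_eqVlt => /predU1P[<-|t0]; first by rewrite eqxx leey.
rewrite gt_eqF// lee_fin /kl divr1.
by have [lnt _] := leif_ln t0; lra.
Qed.

Lemma persp_scale (f : R -> \bar R) (c a b : R) : 0 <= c ->
  persp f (c * a) (c * b) = (c%:E * persp f a b)%E.
Proof.
rewrite le_eqVlt => /predU1P[<-|c0].
  by rewrite /persp !mul0r ltxx mul0e.
rewrite /persp pmulr_rgt0//; case: ifP; last by rewrite mule0.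
by rewrite -mulf_div divff ?gt_eqF// mul1r EFinM muleA.
Qed.

Lemma persp_ge0 (f : R -> \bar R) (a b : R) :
  (forall t, 0 <= t -> (fKL t <= f t)%E) -> 0 <= a -> (0 <= persp f a b)%E.
Proof.
move=> hf a0; rewrite /persp; case: ifP => // b0.
have t0 : 0 <= a / b by rewrite divr_ge0// ltW.
by rewrite mule_ge0 ?lee_fin ?(ltW b0)// (le_trans (fKL_ge0 t0))// hf.
Qed.

Lemma le_persp (f g : R -> \bar R) (a b : R) :
  (forall t, 0 <= t -> (f t <= g t)%E) -> 0 <= a -> (persp f a b <= persp g a b)%E.
Proof.
move=> fg a0; rewrite /persp; case: ifP => // b0.
by rewrite lee_pmul2l ?fin_numE// ?lte_fin// fg// divr_ge0// ltW.
Qed.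

Lemma persp_fKL (a b : R) : 0 <= a -> 0 <= b -> (b = 0 -> a = 0) ->
  persp (@fKL R) a b = (kl a b)%:E.
Proof.
rewrite /persp => a0; rewrite le_eqVlt => /predU1P[<-|b0 _].
  by move=> /(_ erefl) ->; rewrite ltxx kl0l.
rewrite b0 fKL_kl -EFinM /kl divr1 !mulrDr mulrN mulr1 mulrA.
by rewrite [b * _]mulrCA divff ?gt_eqF// mulr1.
Qed.

Lemma persp_fSKL (a b : R) : 0 < a -> 0 < b ->
  persp (@fSKL R) a b = (kl a b + kl b a)%:E.
Proof.
move=> a0 b0; rewrite /persp b0 /fSKL gt_eqF ?divr_gt0// -EFinM; congr EFin.
rewrite mulrA mulrBr mulr1 mulrCA divff ?gt_eqF// mulr1.
by rewrite /kl -(invf_div a b) lnV ?posrE ?divr_gt0//; lra.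
Qed.

End KL.

(* Contribution to [I_f] of one output whose likelihood under input [k] is [a k]. *)
Definition Jinfo (R : realType) (q : nat) (f : R -> \bar R) (pi a : 'I_q -> R) : \bar R :=
  (\sum_(k < q) (pi k)%:E * persp f (a k) (\sum_(j < q) pi j * a j)%R)%E.

(** * Likelihood vectors at one output and at a pair of outputs *)

Section Pointwise.
Context {R : realType} (q : nat) (pi : 'I_q -> R).
Hypothesis pi_gt0 : forall k, 0 < pi k.
Hypothesis pi_sum1 : \sum_(k < q) pi k = 1.

(** For the likelihoods [a k] of a fixed output, this is its marginal probability under [pi]. *)
Definition mix (a : 'I_q -> R) : R := \sum_(j < q) pi j * a j.

Lemma mixD a b : mix (fun k => a k + b k) = mix a + mix b.
Proof. by rewrite -big_split; apply: eq_bigr => k _; rewrite mulrDr. Qed.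

Lemma mixZ c a : mix (fun k => c * a k) = c * mix a.
Proof. by rewrite mulr_sumr; apply: eq_bigr => k _; rewrite mulrCA. Qed.

Lemma mix_cst c : mix (fun=> c) = c.
Proof. by rewrite /mix -mulr_suml pi_sum1 mul1r. Qed.

Lemma mix_ge0 a : (forall k, 0 <= a k) -> 0 <= mix a.
Proof. by move=> a0; apply: sumr_ge0 => k _; rewrite mulr_ge0// ltW. Qed.

Lemma mix_le a b : (forall k, a k <= b k) -> mix a <= mix b.
Proof. by move=> ab; apply: ler_sum => k _; rewrite ler_pM2l. Qed.

Lemma eq_mix a b : (forall k, a k = b k) -> mix a = mix b.
Proof. by move=> ab; apply: eq_bigr => k _; rewrite ab. Qed.

Lemma mix0 a : (forall k, a k = 0) -> mix a = 0.
Proof. by move=> a0; rewrite (eq_mix a0) mix_cst. Qed.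

Lemma mix_eq0 a : (forall k, 0 <= a k) -> mix a = 0 -> forall k, a k = 0.
Proof.
move=> a0 /psumr_eq0P H k.
have /H/(_ k isT)/eqP : forall i, true -> 0 <= pi i * a i.
  by move=> i _; rewrite mulr_ge0// ltW.
by rewrite mulf_eq0 gt_eqF//= => /eqP.
Qed.

Lemma Jinfo_ge0 f a : (forall t, 0 <= t -> (fKL t <= f t)%E) ->
  (forall k, 0 <= a k) -> (0 <= Jinfo f pi a)%E.
Proof.
move=> hf a0; apply: sume_ge0 => k _.
by rewrite mule_ge0 ?lee_fin ?(ltW (pi_gt0 k))// persp_ge0.
Qed.

Lemma Jinfo_cst f c : f 1 = 0%E -> Jinfo f pi (fun=> c) = 0%E.
Proof.
move=> f1; rewrite /Jinfo big1// => k _; rewrite [X in persp _ _ X](mix_cst c).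
by rewrite /persp; case: ifP => // c0; rewrite ?mule0// divff ?gt_eqF// f1 !mule0.
Qed.

Lemma Jinfo_scale f c a : 0 <= c -> (forall t, 0 <= t -> (fKL t <= f t)%E) ->
  (forall k, 0 <= a k) ->
  Jinfo f pi (fun k => c * a k) = (c%:E * Jinfo f pi a)%E.
Proof.
move=> c0 hf a0; rewrite /Jinfo ge0_sume_distrr; last first.
  by move=> k _; rewrite mule_ge0 ?lee_fin ?(ltW (pi_gt0 k))// persp_ge0.
apply: eq_bigr => k _; rewrite [X in persp _ _ X](mixZ c a).
by rewrite persp_scale// muleCA.
Qed.

(** Every term of the sum is nonnegative, hence zero, and [f] vanishes only at 1; a zero marginal
    forces all likelihoods to be zero because [pi] has full support. *)
Lemma Jinfo_eq0 f a : (forall t, 0 <= t -> (fKL t <= f t)%E) ->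
  (forall k, 0 <= a k) -> Jinfo f pi a = 0%E -> forall k, a k = mix a.
Proof.
move=> hf a0 /eqP; rewrite /Jinfo -/(mix a).
rewrite seq_psume_eq0 => [/allP H k|k _]; last first.
  by rewrite mule_ge0 ?lee_fin ?(ltW (pi_gt0 k))// persp_ge0.
have := H k (mem_index_enum _); rewrite mule_eq0 eqe gt_eqF//= /persp.
case: ifPn => [m0|m0 _]; last first.
  have/eqP m00 : mix a == 0 by rewrite eq_le mix_ge0// andbT leNgt.
  by rewrite m00 (mix_eq0 a0).
rewrite mule_eq0 eqe gt_eqF//= => /eqP fk.
have t0 : 0 <= a k / mix a by rewrite divr_ge0// ltW.
have /(congr1 ( *%R^~ (mix a))) : a k / mix a = 1.
  apply: fKL_eq0 => //; apply/eqP; rewrite eq_le fKL_ge0// andbT.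
  by rewrite -fk hf.
by rewrite mul1r divfK// gt_eqF.
Qed.

Lemma Jinfo_KL a : (forall k, 0 <= a k) ->
  Jinfo (@fKL R) pi a = (mix (fun k => kl (a k) (mix a)))%:E.
Proof.
move=> a0; rewrite -sumEFin; apply: eq_bigr => k _.
by rewrite persp_fKL// ?EFinM//; [exact: mix_ge0|move/(mix_eq0 a0)].
Qed.

(** A zero likelihood beside a positive marginal costs [fSKL 0 = +oo]. Once this is excluded, the
    information splits into the two directions of [kl]. *)
Lemma Jinfo_SKL a : (forall k, 0 <= a k) -> (Jinfo (@fSKL R) pi a < +oo)%E ->
  ((forall k, a k = 0) \/ (forall k, 0 < a k)) /\
  Jinfo (@fSKL R) pi a = (mix (fun k => kl (a k) (mix a) + kl (mix a) (a k)))%:E.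
Proof.
move=> a0 Joo.
have [m0|m0] := ltP 0 (mix a); last first.
  have mz : mix a = 0 by apply/eqP; rewrite eq_le m0 mix_ge0.
  have az := mix_eq0 a0 mz.
  split; first by left.
  rewrite /Jinfo -/(mix a) mz big1 => [|k _]; last by rewrite /persp ltxx mule0.
  by rewrite mix0// => k; rewrite az kl0l addr0.
have ap k : 0 < a k.
  rewrite lt_neqAle a0 andbT eq_sym; apply/eqP => ak.
  move: Joo; rewrite /Jinfo (bigD1 k)//= ak -/(mix a) /persp m0 mul0r /fSKL eqxx.
  rewrite gt0_muley ?lte_fin// gt0_muley ?lte_fin// addye ?ltxx//.
  rewrite gt_eqF// (@lt_le_trans _ _ 0%E)// sume_ge0// => i _.
  rewrite mule_ge0 ?lee_fin ?(ltW (pi_gt0 i))//.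
  have := @persp_ge0 R (@fSKL R) (a i) (mix a) (@fKL_le_fSKL R) (a0 i).
  by rewrite /persp m0.
split; first by right.
rewrite -sumEFin; apply: eq_bigr => k _.
by rewrite persp_fSKL// EFinM.
Qed.

Section Product.
Variables a b : 'I_q -> R.
Hypotheses (a0 : forall k, 0 <= a k) (b0 : forall k, 0 <= b k).
Let M := mix (fun k => a k * b k).

(* [mix a * mix b] and [M] both sum to 1 over all pairs of outputs; with them
   on the two sides, the inequality holds pointwise. *)
Lemma kl_prod_le :
  mix (fun k => kl (a k * b k) M) + mix a * mix b <=
  mix (fun k => b k * kl (a k) (mix a)) +
  mix (fun k => a k * kl (b k) (mix b)) + M.
Proof.
have ab0 k : 0 <= a k * b k by rewrite mulr_ge0.
have A0 := mix_ge0 a0; have B0 := mix_ge0 b0.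
have [M0|M0] := ltP 0 M; last first.
  have Mz : M = 0 by apply/eqP; rewrite eq_le M0 mix_ge0.
  have abz := mix_eq0 ab0 Mz.
  rewrite mix0 ?add0r => [|k]; last first.
    by rewrite abz Mz kl0l.
  rewrite Mz addr0 -[leLHS]addr0 lerD//.
    (* If [a k] vanishes, [kl 0 (mix a) = mix a] gives equality; otherwise [b k] vanishes and so do
       both sides. *)
    rewrite -mixZ; apply: mix_le => k.
    have /eqP := abz k; rewrite mulf_eq0 => /predU1P[->|/eqP ->].
      by rewrite kl0l mulrC.
    by rewrite mulr0 mul0r.
  by apply: mix_ge0 => k; rewrite mulr_ge0// kl_ge0// => /(mix_eq0 b0).
(* The logarithms on the two sides differ by [ln (mix a * mix b / M)], bounded by its tangent at 1.
   The last bracket is the resulting linear correction, and it averages to [M - mix a * mix b]. *)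
have le k : kl (a k * b k) M <=
    (b k * kl (a k) (mix a) + a k * kl (b k) (mix b)) +
    ((mix a * mix b / M) * (a k * b k) + (M + - mix a * b k + - mix b * a k)).
  have [ak|ak] := ltP 0 (a k); last first.
    have -> : a k = 0 by apply/eqP; rewrite eq_le ak a0.
    rewrite !mul0r !kl0l; lra.
  have [bk|bk] := ltP 0 (b k); last first.
    have -> : b k = 0 by apply/eqP; rewrite eq_le bk b0.
    rewrite !mul0r !mulr0 !kl0l; lra.
  have A1 : 0 < mix a.
    rewrite lt_neqAle A0 andbT eq_sym; apply/eqP => /(mix_eq0 a0)/(_ k) akz.
    by rewrite akz ltxx in ak.
  have B1 : 0 < mix b.
    rewrite lt_neqAle B0 andbT eq_sym; apply/eqP => /(mix_eq0 b0)/(_ k) bkz.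
    by rewrite bkz ltxx in bk.
  have [ln_le _] := leif_ln (divr_gt0 (mulr_gt0 A1 B1) M0).
  have := ler_wpM2l (ab0 k) ln_le.
  rewrite /kl !ln_div ?posrE ?mulr_gt0// !lnM ?posrE//.
  lra.
apply: le_trans (lerD (mix_le le) (lexx _)) _.
rewrite !mixD !mixZ mix_cst -/M mulfVK ?gt_eqF//.
lra.
Qed.

(** An equality: the forward direction leaves [M * ln (mix a * mix b / M)], and the reverse
    direction leaves its opposite. The weight [M / mix a] is the conditional probability of the
    second output given the first. *)
Lemma skl_prodE :
  (forall k, a k = 0) \/ (forall k, 0 < a k) ->
  (forall k, b k = 0) \/ (forall k, 0 < b k) ->
  mix (fun k => kl (a k * b k) M + kl M (a k * b k)) + 2 * (mix a * mix b) =
  mix (fun k => b k * kl (a k) (mix a) + M / mix a * kl (mix a) (a k)) +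
  mix (fun k => a k * kl (b k) (mix b) + M / mix b * kl (mix b) (b k)) + 2 * M.
Proof.
move=> [az _|ap [bz|bp]].
- have A0 : mix a = 0 by rewrite mix0.
  have Mz : M = 0 by rewrite /M mix0// => k; rewrite az mul0r.
  rewrite Mz A0 [X in X + _ = _]mix0 ?[X in _ = X + _ + _]mix0 ?[X in _ = _ + X + _]mix0; first lra.
  + by move=> k; rewrite az !mul0r addr0.
  + by move=> k; rewrite az kl0l !mul0r mulr0 addr0.
  + by move=> k; rewrite az mul0r kl0l addr0.
- have B0 : mix b = 0 by rewrite mix0.
  have Mz : M = 0 by rewrite /M mix0// => k; rewrite bz mulr0.
  rewrite Mz B0 [X in X + _ = _]mix0 ?[X in _ = X + _ + _]mix0 ?[X in _ = _ + X + _]mix0; first lra.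
  + by move=> k; rewrite bz kl0l !mul0r mulr0 addr0.
  + by move=> k; rewrite bz !mul0r addr0.
  + by move=> k; rewrite bz mulr0 kl0l addr0.
have q0 : (0 < q)%N.
  rewrite lt0n; apply/eqP => qz; move: pi_sum1; rewrite big1 => [/esym/eqP|k _].
    by rewrite oner_eq0.
  by have := ltn_ord k; rewrite {2}qz.
have mixp c : (forall k, 0 < c k) -> 0 < mix c.
  move=> cp; rewrite lt_neqAle mix_ge0 ?andbT 1?eq_sym => [|k]; last exact: ltW.
  apply/eqP => /(mix_eq0 (fun k => ltW (cp k)))/(_ (Ordinal q0)) c0.
  by have := cp (Ordinal q0); rewrite c0 ltxx.
have A1 := mixp _ ap; have B1 := mixp _ bp.
have M1 : 0 < M by apply: mixp => k; rewrite mulr_gt0.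
(* In the average the logarithmic coefficient of [a k * b k] cancels against the one of [M], and the
   correction reduces to [2 * M - 2 * (mix a * mix b)], one unit for each direction. *)
have E k : kl (a k * b k) M + kl M (a k * b k) =
   ((b k * kl (a k) (mix a) + M / mix a * kl (mix a) (a k)) +
    (a k * kl (b k) (mix b) + M / mix b * kl (mix b) (b k))) +
   ((ln (mix a) + ln (mix b) - ln M + 2) * (a k * b k) +
    (- (ln (mix a) + ln (mix b) - ln M - 2) * M +
     (- mix a * b k + (- mix b * a k + (- (M / mix a) * a k + - (M / mix b) * b k))))).
  have X u v : 0 < u -> 0 < v -> M / u * kl u v = M * (ln u - ln v - 1) + M / u * v.
    move=> u0 v0; rewrite /kl ln_div ?posrE//.
    by rewrite mulrDr mulrBr -!mulrA mulKf ?mulVf ?gt_eqF//; lra.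
  rewrite !X// /kl !ln_div ?posrE ?mulr_gt0// !lnM ?posrE//.
  lra.
rewrite (eq_mix E) !mixD !mixZ !mix_cst -/M !mulNr !divfK ?gt_eqF//.
lra.
Qed.

End Product.
End Pointwise.

(** * Subadditivity of the f-information *)

Section Subadditivity.
Context {R : realType} (q : nat) (pi : 'I_q -> R).
Hypothesis pi_gt0 : forall k, 0 < pi k.
Hypothesis pi_sum1 : \sum_(k < q) pi k = 1.
Local Open Scope ereal_scope.
Local Open Scope classical_set_scope.

Definition dchannel (T : choiceType) (W : 'I_q -> T -> R) : Prop :=
  (forall k o, (0 <= W k o)%R) /\
  (forall k, \esum_(o in [set: T]) (W k o)%:E = 1).

Definition prodchan (T1 T2 : choiceType) (W : 'I_q -> T1 -> R)
  (V : 'I_q -> T2 -> R) (k : 'I_q) (p : T1 * T2) : R := (W k p.1 * V k p.2)%R.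

(** Only [W] is fixed: with [V] arbitrary, powers of [W] are handled by splitting off one copy at a
    time, and a symmetry assumption is needed for [W] alone. *)
Definition subadditive (f : R -> \bar R) (T1 : choiceType)
    (W : 'I_q -> T1 -> R) : Prop :=
  forall (T2 : choiceType) (V : 'I_q -> T2 -> R), dchannel V ->
    dinfo f pi (prodchan W V) <= dinfo f pi W + dinfo f pi V.

Lemma esum_marginal (T : choiceType) (V : 'I_q -> T -> R) (c : 'I_q -> R) :
  dchannel V -> (forall k, (0 <= c k)%R) ->
  \esum_(o in [set: T]) (mix pi (fun k => V k o * c k))%:E = (mix pi c)%:E.
Proof.
move=> [V0 V1] c0.
have pi0 k : (0 <= pi k)%R by exact: ltW.
transitivity (\esum_(o in [set: T]) \sum_(k < q) (pi k * c k)%:E * (V k o)%:E).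
  apply: eq_esum => o _; rewrite -sumEFin; apply: eq_bigr => k _.
  by rewrite -EFinM; congr EFin; rewrite -mulrA [(c k * _)%R]mulrC.
rewrite esum_sum; last by move=> o k _ _; rewrite -EFinM lee_fin !mulr_ge0.
rewrite -sumEFin; apply: eq_bigr => k _.
rewrite esumZl ?V1 ?mule1//; first by rewrite lee_fin mulr_ge0.
by move=> o; rewrite lee_fin.
Qed.

Lemma esum_mix (T : choiceType) (V : 'I_q -> T -> R) : dchannel V ->
  \esum_(o in [set: T]) (mix pi (V^~ o))%:E = 1.
Proof.
move=> chV; rewrite -[RHS]/(1%R%:E) -(mix_cst pi_sum1 1) -(esum_marginal chV)//.
apply: eq_esum => o _; congr EFin; apply: eq_mix => k; exact: (esym (mulr1 _)).
Qed.

Section Pair.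
Context (T1 T2 : choiceType) (W : 'I_q -> T1 -> R) (V : 'I_q -> T2 -> R).
Hypotheses (chW : dchannel W) (chV : dchannel V).
Let W0 k o : (0 <= W k o)%R. Proof. by case: chW. Qed.
Let V0 k o : (0 <= V k o)%R. Proof. by case: chV. Qed.

Lemma esum_prod_mix :
  \esum_(p in [set: T1 * T2]) (mix pi (W^~ p.1) * mix pi (V^~ p.2))%:E = 1.
Proof.
have mW o : (0 <= mix pi (W^~ o))%R by exact: mix_ge0.
have mV o : (0 <= mix pi (V^~ o))%R by exact: mix_ge0.
rewrite (esum_pair (a := fun i j => (mix pi (W^~ i) * mix pi (V^~ j))%:E))//; last first.
  by move=> i j; rewrite lee_fin mulr_ge0.
rewrite -[RHS](esum_mix chW); apply: eq_esum => i _.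
under eq_esum do rewrite EFinM.
by rewrite esumZl ?lee_fin// (esum_mix chV) mule1.
Qed.

Lemma esum_mix_pairr (c : 'I_q -> T1 -> R) : (forall k o, (0 <= c k o)%R) ->
  \esum_(p in [set: T1 * T2]) (mix pi (fun k => V k p.2 * c k p.1))%:E =
  \esum_(o in [set: T1]) (mix pi (c^~ o))%:E.
Proof.
move=> c0; rewrite (esum_pair (a := fun i j => (mix pi (fun k => V k j * c k i))%:E)).
  by apply: eq_esum => i _; rewrite (esum_marginal chV).
by move=> i j; rewrite lee_fin mix_ge0// => k; rewrite mulr_ge0.
Qed.

Lemma esum_mix_pairl (c : 'I_q -> T2 -> R) : (forall k o, (0 <= c k o)%R) ->
  \esum_(p in [set: T1 * T2]) (mix pi (fun k => W k p.1 * c k p.2))%:E =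
  \esum_(o in [set: T2]) (mix pi (c^~ o))%:E.
Proof.
move=> c0; rewrite (esum_pairC (a := fun i j => (mix pi (fun k => W k i * c k j))%:E)).
  by apply: eq_esum => i _; rewrite (esum_marginal chW).
by move=> i j; rewrite lee_fin mix_ge0// => k; rewrite mulr_ge0.
Qed.

Lemma esum_mix_prod :
  \esum_(p in [set: T1 * T2]) (mix pi (fun k => W k p.1 * V k p.2))%:E = 1.
Proof. by rewrite esum_mix_pairl// esum_mix. Qed.

Lemma kl_mix_ge0 (T : choiceType) (U : 'I_q -> T -> R) k o :
  (forall k o, (0 <= U k o)%R) -> (0 <= kl (U k o) (mix pi (U^~ o)))%R.
Proof.
move=> U0; rewrite kl_ge0 ?mix_ge0// => U00.
exact: (mix_eq0 pi_gt0 _ U00).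
Qed.

(** Each information on the right becomes a sum over pairs when its terms are weighted by the law of
    the other output given the same input, which has mass 1; [kl_prod_le] then applies to each
    pair. *)
Lemma dinfo_KL_prod :
  dinfo (@fKL R) pi (prodchan W V) <= dinfo (@fKL R) pi W + dinfo (@fKL R) pi V.
Proof.
have mW o : (0 <= mix pi (W^~ o))%R by exact: mix_ge0.
have mV o : (0 <= mix pi (V^~ o))%R by exact: mix_ge0.
have WV0 p k : (0 <= W k p.1 * V k p.2)%R by rewrite mulr_ge0.
(* The 1 added on the left is written as the mass of the product of the marginals; the one on the
   right will be the mass of the joint law. *)
rewrite -(leeD2rE _ _ (isT : 1%:E \is a fin_num)) -{1}esum_prod_mix.
rewrite /dinfo -esumD; last 2 first.
- by move=> p _; exact: (Jinfo_ge0 pi_gt0 (fun _ _ => lexx _) (WV0 p)).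
- by move=> p _; rewrite lee_fin mulr_ge0.
have -> : \esum_(o in [set: T1]) Jinfo (@fKL R) pi (W^~ o) =
    \esum_(p in [set: T1 * T2])
      (mix pi (fun k => V k p.2 * kl (W k p.1) (mix pi (W^~ p.1))))%:E.
  rewrite (esum_mix_pairr (c := fun k o => kl (W k o) (mix pi (W^~ o)))).
    by apply: eq_esum => o _; rewrite Jinfo_KL.
  by move=> k o; exact: kl_mix_ge0.
have -> : \esum_(o in [set: T2]) Jinfo (@fKL R) pi (V^~ o) =
    \esum_(p in [set: T1 * T2])
      (mix pi (fun k => W k p.1 * kl (V k p.2) (mix pi (V^~ p.2))))%:E.
  rewrite (esum_mix_pairl (c := fun k o => kl (V k o) (mix pi (V^~ o)))).
    by apply: eq_esum => o _; rewrite Jinfo_KL.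
  by move=> k o; exact: kl_mix_ge0.
rewrite -esum_mix_prod -!esumD; last 4 first.
- by move=> p _; rewrite -EFinD lee_fin addr_ge0 ?mix_ge0// => k;
    rewrite mulr_ge0// kl_mix_ge0.
- by move=> p _; rewrite lee_fin mix_ge0.
- by move=> p _; rewrite lee_fin mix_ge0// => k; rewrite mulr_ge0// kl_mix_ge0.
- by move=> p _; rewrite lee_fin mix_ge0// => k; rewrite mulr_ge0// kl_mix_ge0.
apply: le_esum => p _.
rewrite [X in X + _](Jinfo_KL pi_gt0 (WV0 p)) -!EFinD lee_fin.
exact: kl_prod_le.
Qed.

Lemma kl_mix_ge0r (T : choiceType) (U : 'I_q -> T -> R) k o :
  (forall k o, (0 <= U k o)%R) ->
  (forall k, U k o = 0%R) \/ (forall k, (0 < U k o)%R) ->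
  (0 <= kl (mix pi (U^~ o)) (U k o))%R.
Proof.
move=> U0 [Uz|Up]; first by rewrite (mix0 pi_sum1 Uz) kl0l.
by rewrite kl_ge0 ?mix_ge0// => Uk; have := Up k; rewrite Uk ltxx.
Qed.

Lemma dinfo_SKL_prod :
  dinfo (@fSKL R) pi (prodchan W V) <= dinfo (@fSKL R) pi W + dinfo (@fSKL R) pi V.
Proof.
have leSKL := @fKL_le_fSKL R.
have IW0 : 0 <= dinfo (@fSKL R) pi W.
  by apply: esum_ge0 => o _; exact: (Jinfo_ge0 pi_gt0 leSKL (W0^~ o)).
have IV0 : 0 <= dinfo (@fSKL R) pi V.
  by apply: esum_ge0 => o _; exact: (Jinfo_ge0 pi_gt0 leSKL (V0^~ o)).
(* An infinite right-hand side is trivial; finiteness makes [Jinfo_SKL] available at every output of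
   both channels. *)
have [->|Woo] := eqVneq (dinfo (@fSKL R) pi W) +oo.
  by rewrite addye ?leey// gt_eqF// (lt_le_trans _ IV0).
have [->|Voo] := eqVneq (dinfo (@fSKL R) pi V) +oo.
  by rewrite addey ?leey// gt_eqF// (lt_le_trans _ IW0).
have fin (T : choiceType) (U : 'I_q -> T -> R) o : (forall k o, (0 <= U k o)%R) ->
    dinfo (@fSKL R) pi U != +oo -> Jinfo (@fSKL R) pi (U^~ o) < +oo.
  move=> U0 Uoo; rewrite (@le_lt_trans _ _ (dinfo (@fSKL R) pi U))// ?ltey//.
  apply: esum_ge; exists [set o] => //; rewrite fsbig_set1//.
have HW o := Jinfo_SKL pi_gt0 pi_sum1 (W0^~ o) (fin _ _ o W0 Woo).
have HV o := Jinfo_SKL pi_gt0 pi_sum1 (V0^~ o) (fin _ _ o V0 Voo).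
have mW o : (0 <= mix pi (W^~ o))%R by exact: mix_ge0.
have mV o : (0 <= mix pi (V^~ o))%R by exact: mix_ge0.
have WV0 p k : (0 <= W k p.1 * V k p.2)%R by rewrite mulr_ge0.
pose M p := mix pi (fun k => W k p.1 * V k p.2)%R.
have M0 p : (0 <= M p)%R by exact: mix_ge0.
pose X p := (mix pi (fun k => V k p.2 * kl (W k p.1) (mix pi (W^~ p.1)) +
   M p / mix pi (W^~ p.1) * kl (mix pi (W^~ p.1)) (W k p.1)))%R.
pose Y p := (mix pi (fun k => W k p.1 * kl (V k p.2) (mix pi (V^~ p.2)) +
   M p / mix pi (V^~ p.2) * kl (mix pi (V^~ p.2)) (V k p.2)))%R.
have X0 p : (0 <= X p)%R.
  apply: mix_ge0 => // k; rewrite addr_ge0// mulr_ge0 ?kl_mix_ge0//.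
    by rewrite divr_ge0.
  by rewrite (@kl_mix_ge0r _ W)//; case: (HW p.1).
have Y0 p : (0 <= Y p)%R.
  apply: mix_ge0 => // k; rewrite addr_ge0// mulr_ge0 ?kl_mix_ge0//.
    by rewrite divr_ge0.
  by rewrite (@kl_mix_ge0r _ V)//; case: (HV p.2).
(* the weight [M / m] is a convex combination of the conditional weights, so
   integrating out the other output leaves the reverse divergence *)
have -> : dinfo (@fSKL R) pi W = \esum_(p in [set: T1 * T2]) (X p)%:E.
  pose c k o := (kl (W k o) (mix pi (W^~ o)) +
    W k o / mix pi (W^~ o) * mix pi (fun j => kl (mix pi (W^~ o)) (W j o)))%R.
  have c0 k o : (0 <= c k o)%R.
    rewrite addr_ge0 ?kl_mix_ge0// mulr_ge0 ?divr_ge0// mix_ge0// => j.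
    by rewrite (@kl_mix_ge0r _ W)//; case: (HW o).
  transitivity (\esum_(p in [set: T1 * T2]) (mix pi (fun k => V k p.2 * c k p.1))%:E).
    rewrite (esum_mix_pairr c0); apply: eq_esum => o _.
    have [Wo JW] := HW o; rewrite [LHS]JW; congr EFin; rewrite mixD [RHS]mixD; congr (_ + _)%R; symmetry.
    rewrite (@eq_mix _ _ pi (fun k => _ * _)%R (fun k => (mix pi (W^~ o))^-1 *
      mix pi (fun j => kl (mix pi (W^~ o)) (W j o)) * W k o)%R); last by move=> k; ring.
    rewrite mixZ; have [mz|mz] := eqVneq (mix pi (W^~ o)) 0%R.
      have Wz := mix_eq0 pi_gt0 (W0^~ o) mz.
      by rewrite mz mulr0 mix0// => k; rewrite kl0l Wz.
    by rewrite mulrAC mulVf ?mul1r.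
  apply: eq_esum => p _; congr EFin; rewrite /X mixD mixZ.
  rewrite (@eq_mix _ _ pi (fun k => _ * c _ _)%R
     (fun k => V k p.2 * kl (W k p.1) (mix pi (W^~ p.1)) +
      (mix pi (W^~ p.1))^-1 * mix pi (fun j => kl (mix pi (W^~ p.1)) (W j p.1)) *
       (W k p.1 * V k p.2))%R); last by move=> k; rewrite /c; ring.
  rewrite mixD mixZ -/(M p); lra.
have -> : dinfo (@fSKL R) pi V = \esum_(p in [set: T1 * T2]) (Y p)%:E.
  pose c k o := (kl (V k o) (mix pi (V^~ o)) +
    V k o / mix pi (V^~ o) * mix pi (fun j => kl (mix pi (V^~ o)) (V j o)))%R.
  have c0 k o : (0 <= c k o)%R.
    rewrite addr_ge0 ?kl_mix_ge0// mulr_ge0 ?divr_ge0// mix_ge0// => j.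
    by rewrite (@kl_mix_ge0r _ V)//; case: (HV o).
  transitivity (\esum_(p in [set: T1 * T2]) (mix pi (fun k => W k p.1 * c k p.2))%:E).
    rewrite (esum_mix_pairl c0); apply: eq_esum => o _.
    have [Vo JV] := HV o; rewrite [LHS]JV; congr EFin; rewrite mixD [RHS]mixD; congr (_ + _)%R; symmetry.
    rewrite (@eq_mix _ _ pi (fun k => _ * _)%R (fun k => (mix pi (V^~ o))^-1 *
      mix pi (fun j => kl (mix pi (V^~ o)) (V j o)) * V k o)%R); last by move=> k; ring.
    rewrite mixZ; have [mz|mz] := eqVneq (mix pi (V^~ o)) 0%R.
      have Vz := mix_eq0 pi_gt0 (V0^~ o) mz.
      by rewrite mz mulr0 mix0// => k; rewrite kl0l Vz.
    by rewrite mulrAC mulVf ?mul1r.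
  apply: eq_esum => p _; congr EFin; rewrite /Y mixD mixZ.
  rewrite (@eq_mix _ _ pi (fun k => _ * c _ _)%R
     (fun k => W k p.1 * kl (V k p.2) (mix pi (V^~ p.2)) +
      (mix pi (V^~ p.2))^-1 * mix pi (fun j => kl (mix pi (V^~ p.2)) (V j p.2)) *
       (W k p.1 * V k p.2))%R); last by move=> k; rewrite /c; ring.
  rewrite mixD mixZ -/(M p); lra.
have esum2 (h : T1 * T2 -> R) : (forall p, 0 <= h p)%R ->
    \esum_(p in [set: T1 * T2]) (h p)%:E = 1 ->
    \esum_(p in [set: T1 * T2]) (2 * h p)%:E = (2 : R)%:E.
  move=> h0 h1; under eq_esum do rewrite EFinM.
  by rewrite esumZl ?h1 ?mule1 ?lee_fin// => p; rewrite lee_fin.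
rewrite -(leeD2rE _ _ (isT : (2 : R)%:E \is a fin_num)).
rewrite -{1}(esum2 _ _ esum_prod_mix); last by move=> p; rewrite mulr_ge0.
rewrite -(esum2 M M0 esum_mix_prod).
rewrite /dinfo -[leLHS]esumD; last 2 first.
- by move=> p _; exact: (Jinfo_ge0 pi_gt0 leSKL (WV0 p)).
- by move=> p _; rewrite lee_fin !mulr_ge0.
rewrite -!esumD; last 4 first.
- by move=> p _; rewrite -EFinD lee_fin addr_ge0.
- by move=> p _; rewrite lee_fin mulr_ge0.
- by move=> p _; rewrite lee_fin.
- by move=> p _; rewrite lee_fin.
apply: le_esum => p _.
have [Wp _] := HW p.1; have [Vp _] := HV p.2.
(* Finiteness for the product is not known at this point, so [Jinfo_SKL] cannot be applied to it.
   Instead the dichotomy, all likelihoods zero or all positive, is inherited from the factors. *)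
have Jp : Jinfo (@fSKL R) pi (fun k => W k p.1 * V k p.2)%R =
  (mix pi (fun k => kl (W k p.1 * V k p.2) (M p) + kl (M p) (W k p.1 * V k p.2)))%:E.
  rewrite -sumEFin; apply: eq_bigr => k _; rewrite -/(mix pi _) -/(M p) EFinM.
  have [WVk|WVk] := ltP 0%R (W k p.1 * V k p.2)%R.
    rewrite persp_fSKL// lt_neqAle M0 andbT eq_sym.
    apply/eqP => /(mix_eq0 pi_gt0 (WV0 p))/(_ k) z.
    by rewrite z ltxx in WVk.
  have z : (W k p.1 * V k p.2 = 0)%R by apply/eqP; rewrite eq_le WVk WV0.
  have Mz : M p = 0%R.
    apply: mix0 => // j; have /eqP := z; rewrite mulf_eq0 => /orP[] /eqP zk.
      case: Wp => [->|/(_ k)]; rewrite ?mul0r//.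
      by rewrite zk ltxx.
    case: Vp => [->|/(_ k)]; rewrite ?mulr0//.
    by rewrite zk ltxx.
  by rewrite z Mz kl0l addr0 /persp ltxx.
rewrite [X in X + _]Jp -!EFinD lee_fin.
by rewrite skl_prodE.
Qed.

End Pair.
End Subadditivity.

(** * The chi-square information under a uniform binary input *)

Section ChiSquare.
Context {R : realType}.

Lemma unif2_gt0 (k : 'I_2) : 0 < @unif2 R k.
Proof. by rewrite /unif2 invr_gt0. Qed.

Lemma big_ord2 (T : Type) (idx : T) (op : Monoid.law idx) (F : 'I_2 -> T) :
  \big[op/idx]_(k < 2) F k = op (F ord0) (F ord_max).
Proof. by rewrite big_ord_recr big_ord1; congr (op (F _) _); apply: val_inj. Qed.

Lemma unif2_sum1 : \sum_(k < 2) @unif2 R k = 1.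
Proof. by rewrite big_ord2 /unif2/=; lra. Qed.

Lemma flip2_0 : flip2 ord0 = ord_max. Proof. exact: val_inj. Qed.
Lemma flip2_1 : flip2 ord_max = ord0. Proof. exact: val_inj. Qed.
Lemma flip2K : involutive flip2. Proof. exact: rev_ordK. Qed.

Lemma mix_flip2 (a : 'I_2 -> R) :
  mix (@unif2 R) (fun k => a (flip2 k)) = mix (@unif2 R) a.
Proof. by rewrite /mix !big_ord2/= flip2_0 flip2_1 /unif2 addrC. Qed.

(** Half the triangular discrimination. The convention that 0 has inverse 0 gives the value 0 at
    [u + v = 0], in agreement with [persp]. *)
Definition chi2 (u v : R) : R := (u - v) ^+ 2 / (2 * (u + v)).

Lemma Jinfo_chi2 (a : 'I_2 -> R) : (forall k, 0 <= a k) ->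
  Jinfo (@fchi2 R) (@unif2 R) a = (chi2 (a ord0) (a ord_max))%:E.
Proof.
move=> a0; rewrite /Jinfo -/(mix _ a).
have -> : mix (@unif2 R) a = (a ord0 + a ord_max) / 2.
  by rewrite /mix big_ord2/= /unif2; lra.
rewrite big_ord2/= /unif2.
have [s0|s0] := ltP 0 (a ord0 + a ord_max).
  rewrite /persp divr_gt0// /fchi2 -!EFinM -EFinD /chi2; congr EFin.
  by field; rewrite gt_eqF.
have s00 : a ord0 + a ord_max = 0 by apply/eqP; rewrite eq_le s0 addr_ge0.
by rewrite /persp /chi2 s00 mul0r ltxx !mule0 adde0 mulr0 invr0 mulr0.
Qed.

(** Here [x] and [y] are the biases of two outputs, and the fractions belong to the pair and to the
    pair with one output flipped. Over the common denominator the claim becomes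
    [x^2 y^2 (x^2 + y^2) <= 2 x^2 y^2]. *)
Lemma chi2_normalized (x y : R) : -1 <= x <= 1 -> -1 <= y <= 1 ->
  (x + y) ^+ 2 / (1 + x * y) + (x - y) ^+ 2 / (1 - x * y) <=
  2 * (x ^+ 2 + y ^+ 2).
Proof.
move=> /andP[x1 x2] /andP[y1 y2].
have X : x ^+ 2 <= 1 by rewrite expr2; nra.
have Y : y ^+ 2 <= 1 by rewrite expr2; nra.
have X0 : 0 <= x ^+ 2 by exact: sqr_ge0.
have Y0 : 0 <= y ^+ 2 by exact: sqr_ge0.
have P0 : 0 <= 1 + x * y.
  have : 0 <= (1 + x) * (1 + y) by rewrite mulr_ge0//; lra.
  have : 0 <= (1 - x) * (1 - y) by rewrite mulr_ge0//; lra.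
  lra.
have N0 : 0 <= 1 - x * y.
  have : 0 <= (1 + x) * (1 - y) by rewrite mulr_ge0//; lra.
  have : 0 <= (1 - x) * (1 + y) by rewrite mulr_ge0//; lra.
  lra.
(* A fraction with zero denominator is 0 by convention, and the other then has denominator 2. *)
have [Pz|Pn] := eqVneq (1 + x * y) 0.
  have xy : x * y = -1 by lra.
  rewrite xy subrr invr0 mulr0 opprK -[1 + 1]/(2%:R).
  have : (x - y) ^+ 2 = x ^+ 2 + y ^+ 2 + 2 by rewrite sqrrB; lra.
  have : (x + y) ^+ 2 = x ^+ 2 + y ^+ 2 - 2 by rewrite sqrrD; lra.
  have := sqr_ge0 (x + y); lra.
have [Nz|Nn] := eqVneq (1 - x * y) 0.
  have xy : x * y = 1 by lra.
  rewrite xy subrr invr0 mulr0 -[1 + 1]/(2%:R).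
  have : (x - y) ^+ 2 = x ^+ 2 + y ^+ 2 - 2 by rewrite sqrrB; lra.
  have : (x + y) ^+ 2 = x ^+ 2 + y ^+ 2 + 2 by rewrite sqrrD; lra.
  have := sqr_ge0 (x - y); lra.
have P1 : 0 < 1 + x * y by rewrite lt_neqAle eq_sym Pn.
have N1 : 0 < 1 - x * y by rewrite lt_neqAle eq_sym Nn.
rewrite addf_div ?gt_eqF// ler_pdivrMr ?mulr_gt0//.
have -> : (x + y) ^+ 2 * (1 - x * y) + (x - y) ^+ 2 * (1 + x * y) =
  2 * (x ^+ 2 + y ^+ 2 - 2 * (x ^+ 2 * y ^+ 2)) by ring.
have -> : (1 + x * y) * (1 - x * y) = 1 - x ^+ 2 * y ^+ 2 by ring.
have : x ^+ 2 * y ^+ 2 * (x ^+ 2 + y ^+ 2) <= x ^+ 2 * y ^+ 2 * 2.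
  by apply: ler_wpM2l; [exact: mulr_ge0|lra].
lra.
Qed.

(* The bound fails pointwise and holds only after averaging over the flip of
   one observation. *)
Lemma chi2_prod_le (a0 a1 b0 b1 : R) :
  0 <= a0 -> 0 <= a1 -> 0 <= b0 -> 0 <= b1 ->
  chi2 (a0 * b0) (a1 * b1) + chi2 (a1 * b0) (a0 * b1) <=
  (b0 + b1) * chi2 a0 a1 + (a0 + a1) * chi2 b0 b1.
Proof.
move=> ha0 ha1 hb0 hb1.
have [s0|s0] := ltP 0 (a0 + a1); last first.
  have -> : a0 = 0 by lra.
  have -> : a1 = 0 by lra.
  by rewrite /chi2 !(mul0r, subrr, addr0, expr0n, mulr0).
have [t0|t0] := ltP 0 (b0 + b1); last first.
  have -> : b0 = 0 by lra.
  have -> : b1 = 0 by lra.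
  by rewrite /chi2 !(mul0r, subrr, addr0, expr0n, mulr0).
(* Change to total masses [s], [t] and biases [x], [y]; every product of likelihoods then carries
   the factor [s * t / 4]. *)
pose s := a0 + a1; pose t := b0 + b1.
pose x := (a0 - a1) / s; pose y := (b0 - b1) / t.
have sx : a0 - a1 = s * x by rewrite /x mulrC divfK// gt_eqF.
have ty : b0 - b1 = t * y by rewrite /y mulrC divfK// gt_eqF.
have x1 : -1 <= x <= 1.
  by rewrite /x ler_pdivlMr// ler_pdivrMr// /s; apply/andP; split; lra.
have y1 : -1 <= y <= 1.
  by rewrite /y ler_pdivlMr// ler_pdivrMr// /t; apply/andP; split; lra.
have ea0 : a0 = s * (1 + x) / 2 by rewrite mulrDr -sx /s; lra.
have ea1 : a1 = s * (1 - x) / 2 by rewrite mulrBr -sx /s; lra.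
have eb0 : b0 = t * (1 + y) / 2 by rewrite mulrDr -ty /t; lra.
have eb1 : b1 = t * (1 - y) / 2 by rewrite mulrBr -ty /t; lra.
have st0 : 0 < s * t / 4 by rewrite divr_gt0// mulr_gt0.
have L (u v w z : R) : u - v = 2 * (s * t / 4) * w -> u + v = 2 * (s * t / 4) * z ->
    chi2 u v = (s * t / 4) * (w ^+ 2 / z).
  move=> uw vz; rewrite /chi2 uw vz.
  have [->|z0] := eqVneq z 0; first by rewrite mulr0 mulr0 invr0 !mulr0.
  by field; rewrite z0 /= !gt_eqF.
rewrite (L (a0 * b0) (a1 * b1) (x + y) (1 + x * y)); last 2 first.
- by rewrite ea0 ea1 eb0 eb1; field.
- by rewrite ea0 ea1 eb0 eb1; field.
rewrite (L (a1 * b0) (a0 * b1) (y - x) (1 - x * y)); last 2 first.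
- by rewrite ea0 ea1 eb0 eb1; field.
- by rewrite ea0 ea1 eb0 eb1; field.
have -> : chi2 a0 a1 = s / 2 * x ^+ 2.
  by rewrite /chi2 sx -/s; field; rewrite gt_eqF.
have -> : chi2 b0 b1 = t / 2 * y ^+ 2.
  by rewrite /chi2 ty -/t; field; rewrite gt_eqF.
rewrite -mulrDr -/s -/t -[(y - x) ^+ 2]sqrrN opprB.
apply: (le_trans (ler_wpM2l (ltW st0) (chi2_normalized x1 y1))).
lra.
Qed.

Local Open Scope ereal_scope.
Local Open Scope classical_set_scope.

Lemma dinfo_chi2_prod (T1 T2 : choiceType) (s : T1 -> T1)
    (W : 'I_2 -> T1 -> R) (V : 'I_2 -> T2 -> R) :
  involutive s -> (forall k o, W k (s o) = W (flip2 k) o) ->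
  dchannel W -> dchannel V ->
  dinfo (@fchi2 R) (@unif2 R) (prodchan W V) <=
  dinfo (@fchi2 R) (@unif2 R) W + dinfo (@fchi2 R) (@unif2 R) V.
Proof.
move=> sK Ws chW chV.
have [W0 _] := chW; have [V0 _] := chV.
have pi0 := unif2_gt0; have pi1 := unif2_sum1.
have WV0 (p : T1 * T2) k : (0 <= prodchan W V k p)%R by rewrite mulr_ge0.
have WV0' (p : T1 * T2) k : (0 <= prodchan W V k (s p.1, p.2))%R by rewrite mulr_ge0.
have J0 (a : 'I_2 -> R) : (forall k, 0 <= a k)%R -> 0 <= Jinfo (@fchi2 R) (@unif2 R) a.
  exact: (Jinfo_ge0 pi0 (@fKL_le_fchi2 R)).
have I0 : 0 <= dinfo (@fchi2 R) (@unif2 R) W + dinfo (@fchi2 R) (@unif2 R) V.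
  by rewrite adde_ge0// esum_ge0// => o _; [exact: (J0 (W^~ o))|exact: (J0 (V^~ o))].
(* Doubling leaves one copy as it is and lets the other be reindexed by the flip [s] of the first
   output, which provides the average required by [chi2_prod_le]. *)
suff : dinfo (@fchi2 R) (@unif2 R) (prodchan W V) *+ 2 <=
       (dinfo (@fchi2 R) (@unif2 R) W + dinfo (@fchi2 R) (@unif2 R) V) *+ 2.
  by rewrite -!mule_natl lee_pmul2l// lte_fin.
have flipE : dinfo (@fchi2 R) (@unif2 R) (prodchan W V) =
    \esum_(p in [set: T1 * T2])
      Jinfo (@fchi2 R) (@unif2 R) (fun k => W (flip2 k) p.1 * V k p.2)%R.
  rewrite /dinfo (@reindex_esum _ _ _ setT setT (fun p : T1 * T2 => (s p.1, p.2))).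
    apply: eq_esum => p _; rewrite -/(Jinfo _ _ (fun k => prodchan W V k (s p.1, p.2))).
    congr Jinfo; apply/funext => k; by rewrite /prodchan /= Ws.
  split => //= [[x1 x2] [y1 y2] _ _ [/(can_inj sK) -> ->]//|[x1 x2] _].
  by exists (s x1, x2); rewrite //= sK.
rewrite !mule2n {2}flipE /dinfo -esumD; last 2 first.
- by move=> p _; exact: (J0 _ (WV0 p)).
- by move=> p _; apply: J0 => k; rewrite mulr_ge0.
pose m (a : 'I_2 -> R) := mix (@unif2 R) a.
have mE (a : 'I_2 -> R) : (2 * m a = a ord0 + a ord_max)%R.
  by rewrite /m /mix big_ord2/= /unif2; lra.
have mW o : (0 <= m (W^~ o))%R by exact: mix_ge0.
have mV o : (0 <= m (V^~ o))%R by exact: mix_ge0.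
have EW : \esum_(o in [set: T1]) Jinfo (@fchi2 R) (@unif2 R) (W^~ o) =
   \esum_(p in [set: T1 * T2])
     ((m (V^~ p.2))%:E * Jinfo (@fchi2 R) (@unif2 R) (W^~ p.1)).
  rewrite (esum_pair (a := fun i j => (m (V^~ j))%:E * Jinfo _ _ (W^~ i))); last first.
    by move=> i j; rewrite mule_ge0 ?lee_fin// J0.
  apply: eq_esum => i _; under [RHS]eq_esum do rewrite muleC.
  by rewrite esumZl ?J0// ?(esum_mix pi0 pi1 chV) ?mule1// => j; rewrite lee_fin.
have EV : \esum_(o in [set: T2]) Jinfo (@fchi2 R) (@unif2 R) (V^~ o) =
   \esum_(p in [set: T1 * T2])
     ((m (W^~ p.1))%:E * Jinfo (@fchi2 R) (@unif2 R) (V^~ p.2)).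
  rewrite (esum_pairC (a := fun i j => (m (W^~ i))%:E * Jinfo _ _ (V^~ j))); last first.
    by move=> i j; rewrite mule_ge0 ?lee_fin// J0.
  apply: eq_esum => i _; under [RHS]eq_esum do rewrite muleC.
  by rewrite esumZl ?J0// ?(esum_mix pi0 pi1 chW) ?mule1// => j; rewrite lee_fin.
have EJ0 p : 0 <= (m (V^~ p.2))%:E * Jinfo (@fchi2 R) (@unif2 R) (W^~ p.1) +
    (m (W^~ p.1))%:E * Jinfo (@fchi2 R) (@unif2 R) (V^~ p.2).
  by rewrite adde_ge0// mule_ge0 ?lee_fin ?J0.
rewrite EW EV -!esumD//; last 2 first.
- by move=> p _; rewrite mule_ge0 ?lee_fin ?J0.
- by move=> p _; rewrite mule_ge0 ?lee_fin ?J0.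
apply: le_esum => p _; rewrite -/(Jinfo _ _ (fun k => prodchan W V k p)).
rewrite !Jinfo_chi2//; last by move=> k; rewrite mulr_ge0.
rewrite flip2_0 flip2_1 -!EFinM -!EFinD lee_fin.
have := chi2_prod_le (W0 ord0 p.1) (W0 ord_max p.1) (V0 ord0 p.2) (V0 ord_max p.2).
rewrite /prodchan -(mE (W^~ p.1)) -(mE (V^~ p.2)).
lra.
Qed.

End ChiSquare.

(** * Products, forests and compositions of channels *)

Section Channels.
Context {R : realType} (q : nat) (pi : 'I_q -> R).
Hypothesis pi_gt0 : forall k, 0 < pi k.
Hypothesis pi_sum1 : \sum_(k < q) pi k = 1.
Variable f : R -> \bar R.
Hypothesis f1 : f 1 = 0%E.
Hypothesis fKL_le : forall t, 0 <= t -> (fKL t <= f t)%E.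
Local Open Scope ereal_scope.
Local Open Scope classical_set_scope.

Lemma dinfo_ge0 (T : choiceType) (W : 'I_q -> T -> R) :
  (forall k o, (0 <= W k o)%R) -> 0 <= dinfo f pi W.
Proof. by move=> W0; apply: esum_ge0 => o _; exact: (Jinfo_ge0 pi_gt0 fKL_le (W0^~ o)). Qed.

Definition iidchan (T : choiceType) n (W : 'I_q -> T -> R) (k : 'I_q)
  (t : n.-tuple T) : R := (\prod_(e <- t) W k e)%R.

Lemma dchannel_iid (T : choiceType) n (W : 'I_q -> T -> R) :
  dchannel W -> dchannel (@iidchan T n W).
Proof.
move=> [W0 W1]; split=> [k t|k]; first by rewrite /iidchan prodr_ge0.
rewrite -[RHS](@esum_tuple_prod1 R T n (fun=> W k))//.
by apply: eq_esum => t _; rewrite /iidchan big_tuple.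
Qed.

Lemma dinfo_iid_le (T : choiceType) n (W : 'I_q -> T -> R) :
  dchannel W -> subadditive pi f W ->
  dinfo f pi (@iidchan T n W) <= n%:R%:E * dinfo f pi W.
Proof.
move=> chW subW; have [W0 W1] := chW.
elim: n => [|n IH].
  rewrite /dinfo esum1 ?mul0e// => t _.
  rewrite -[RHS](Jinfo_cst pi_sum1 1 f1); congr Jinfo.
  by apply/funext => k; rewrite /iidchan tuple0 big_nil.
have -> : dinfo f pi (@iidchan T n.+1 W) = dinfo f pi (prodchan W (@iidchan T n W)).
  have prod0 k p : (0 <= prodchan W (@iidchan T n W) k p)%R.
    by rewrite mulr_ge0// prodr_ge0.
  have iid0 k p : (0 <= @iidchan T n.+1 W k p)%R by rewrite prodr_ge0.
  rewrite /dinfo esum_tupleS; last first.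
    by move=> t; exact: (Jinfo_ge0 pi_gt0 fKL_le (iid0^~ t)).
  rewrite (esum_pair (a := fun i j => Jinfo f pi (prodchan W (@iidchan T n W) ^~ (i, j)))).
    apply: eq_esum => o _; apply: eq_esum => t _; congr Jinfo; apply/funext => k.
    by rewrite /iidchan /prodchan /= big_cons.
  by move=> i j; exact: (Jinfo_ge0 pi_gt0 fKL_le (prod0^~ (i, j))).
apply: le_trans (subW _ _ (dchannel_iid n chW)) _.
rewrite -natr1 EFinD ge0_muleDl ?lee_fin// mul1e addeC leeD2r//.
Qed.

Definition forest (T : choiceType) (D : nat -> R) (W : 'I_q -> T -> R)
  (k : 'I_q) (es : seq T) : R := (D (size es) * \prod_(e <- es) W k e)%R.

Lemma dchannel_forest (T : choiceType) (D : nat -> R) (W : 'I_q -> T -> R) :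
  (forall t, (0 <= D t)%R) -> \sum_(t <oo) (D t)%:E = 1 ->
  dchannel W -> dchannel (forest D W).
Proof.
move=> D0 D1 chW; have [W0 W1] := chW; split=> [k es|k].
  by rewrite /forest mulr_ge0// prodr_ge0.
rewrite esum_seq => [|es]; last by rewrite lee_fin mulr_ge0// prodr_ge0.
rewrite -[RHS]D1; apply: eq_eseriesr => n _.
have [_ iid1] := dchannel_iid n chW.
transitivity (\esum_(t in [set: n.-tuple T]) ((D n)%:E * (@iidchan T n W k t)%:E)).
  by apply: eq_esum => t _; rewrite /forest size_tuple EFinM.
rewrite esumZl ?lee_fin// ?iid1 ?mule1// => t.
by rewrite lee_fin prodr_ge0.
Qed.

(** The number of hyperedges is observed and independent of the label, so the information is the
    [D]-average of those of the [t]-fold products, each at most [t] times that of [W]. *)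
Lemma dinfo_forest_le (T : choiceType) (D : nat -> R) dm (W : 'I_q -> T -> R) :
  is_offspring D dm -> dchannel W -> subadditive pi f W ->
  dinfo f pi (forest D W) <= dm%:E * dinfo f pi W.
Proof.
move=> [D0 D1 Dm] chW subW; have [W0 W1] := chW.
have iid0 n k p : (0 <= @iidchan T n W k p)%R by rewrite prodr_ge0.
have [F0 _] := dchannel_forest D0 D1 chW.
rewrite /dinfo esum_seq; last by move=> es; exact: (Jinfo_ge0 pi_gt0 fKL_le (F0^~ es)).
rewrite nneseries_esumT; last first.
  move=> n; apply: esum_ge0 => es _; exact: (Jinfo_ge0 pi_gt0 fKL_le (F0^~ (val es))).
rewrite -Dm nneseries_esumT; last by move=> n; rewrite lee_fin mulr_ge0.
rewrite [leRHS]muleC -esumZl; last 2 first.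
- exact: dinfo_ge0.
- by move=> n; rewrite lee_fin mulr_ge0.
apply: le_esum => n _; rewrite muleC mulrC EFinM -muleA.
apply: (@le_trans _ _ ((D n)%:E * dinfo f pi (@iidchan T n W))); last first.
  by rewrite lee_wpmul2l ?lee_fin// dinfo_iid_le.
rewrite /dinfo -esumZl ?lee_fin//; last first.
  by move=> t; exact: (Jinfo_ge0 pi_gt0 fKL_le ((iid0 n)^~ t)).
apply: le_esum => t _; rewrite -[leRHS](Jinfo_scale pi_gt0 (D0 n) fKL_le ((iid0 n)^~ t)).
rewrite le_eqVlt; apply/orP; left; apply/eqP; congr Jinfo; apply/funext => k.
by rewrite /forest size_tuple.
Qed.

Definition compchan n (B : 'I_q -> n.-tuple 'I_q -> R) (T : choiceType)
  (W : 'I_q -> T -> R) (k : 'I_q) (e : n.-tuple T) : R :=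
  (\sum_(x : n.-tuple 'I_q) B k x * \prod_(i < n) W (tnth x i) (tnth e i))%R.

Lemma dchannel_comp n (B : 'I_q -> n.-tuple 'I_q -> R) (T : choiceType)
    (W : 'I_q -> T -> R) :
  (forall k x, (0 <= B k x)%R) -> (forall k, (\sum_x B k x = 1)%R) ->
  dchannel W -> dchannel (compchan B W).
Proof.
move=> B0 B1 [W0 W1]; split=> [k e|k].
  by apply: sumr_ge0 => x _; rewrite mulr_ge0// prodr_ge0.
under eq_esum do rewrite -sumEFin.
rewrite esum_sum; last by move=> e x _ _; rewrite lee_fin mulr_ge0// prodr_ge0.
transitivity (\sum_x (B k x)%:E); last by rewrite sumEFin B1.
apply: eq_bigr => x _.
under eq_esum do rewrite EFinM.
rewrite esumZl ?lee_fin//; last by move=> e; rewrite lee_fin prodr_ge0.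
by rewrite (@esum_tuple_prod1 _ _ _ (fun i => W (tnth x i))) ?mule1.
Qed.

(* Channels with zero information are not covered by the supremum defining [eta]. *)
Lemma dinfo_comp_eq0 n (B : 'I_q -> n.-tuple 'I_q -> R) (T : choiceType)
    (W : 'I_q -> T -> R) :
  (forall k, (\sum_x B k x = 1)%R) -> (forall k o, (0 <= W k o)%R) ->
  dinfo f pi W = 0 -> dinfo f pi (compchan B W) = 0.
Proof.
move=> B1 W0 I0.
have WE k o : W k o = mix pi (W^~ o).
  apply: (Jinfo_eq0 pi_gt0 fKL_le (W0^~ o)).
  apply/eqP; rewrite eq_le (Jinfo_ge0 pi_gt0 fKL_le (W0^~ o)) andbT -I0.
  apply: esum_ge; exists [set o] => //; rewrite fsbig_set1//.
rewrite /dinfo esum1// => e _.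
rewrite -[RHS](Jinfo_cst pi_sum1 (\prod_(i < n) mix pi (W^~ (tnth e i)))%R f1).
congr Jinfo; apply/funext => k; rewrite /compchan.
under eq_bigr do under eq_bigr do rewrite WE.
by rewrite -mulr_suml B1 mul1r.
Qed.

End Channels.

(** Reindexing the sum over [x] by the coordinatewise flip moves the flip from the outputs to the
    inputs of [W], and the symmetry of [B] moves it on to [k]. *)
Lemma compchan_flip2 (R : realType) n (B : 'I_2 -> n.-tuple 'I_2 -> R)
    (T : choiceType) (W : 'I_2 -> T -> R) (s : T -> T) k (e : n.-tuple T) :
  (forall k x, B k x = B (flip2 k) (map_tuple flip2 x)) ->
  (forall k o, W k (s o) = W (flip2 k) o) ->
  compchan B W k (map_tuple s e) = compchan B W (flip2 k) e.
Proof.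
move=> Bs Ws; rewrite /compchan.
have mK : involutive (map_tuple flip2 : n.-tuple 'I_2 -> n.-tuple 'I_2).
  by move=> x; apply: eq_from_tnth => i; rewrite !tnth_map flip2K.
rewrite [RHS](reindex_inj (inv_inj mK)); apply: eq_bigr => x _.
rewrite -Bs; congr (_ * _); apply: eq_bigr => i _.
by rewrite !tnth_map Ws.
Qed.

(** * Countable channels as measurable channels *)

(** Links [compdens], whose outputs form a plain list, to the tuples of [compchan]. *)
Lemma prod_zip_tnth (R : comPzRingType) (S T : Type) n (F : S -> T -> R)
    (x : n.-tuple S) (t : n.-tuple T) :
  \prod_(ij <- zip x t) F ij.1 ij.2 = \prod_(i < n) F (tnth x i) (tnth t i).
Proof.
elim: n x t => [|n IH] x t; first by rewrite (tuple0 x) (tuple0 t)/= big_nil big_ord0.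
case/tupleP: x => a x; case/tupleP: t => b t.
rewrite big_cons IH big_ord_recl !tnth0/=; congr (_ * _).
by apply: eq_bigr => i _; rewrite !tnthS.
Qed.

Section Realization.
Context {R : realType} (q : nat) (pi : 'I_q -> R).
Hypothesis pi_gt0 : forall k, 0 < pi k.
Hypothesis pi_sum1 : \sum_(k < q) pi k = 1.
Variable f : R -> \bar R.
Hypothesis fKL_le : forall t, 0 <= t -> (fKL t <= f t)%E.
Context (T : choiceType) (x0 : T) (W : 'I_q -> T -> R).
Hypothesis chW : dchannel W.
Local Open Scope ereal_scope.
Local Open Scope classical_set_scope.

(** Reference mass [m] and density [p]. Where [m] vanishes so does every [W k], and the division by
    zero in [p] is harmless. *)
Let m (o : T) : R := mix pi (W^~ o).
Let p (k : 'I_q) (o : disc x0) : R := (W k o / m o)%R.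
Variable mu : probability (disc x0) R.
Hypothesis muE : forall g : T -> \bar R, (forall o, 0 <= g o) ->
  \int[mu]_(y in setT) g y = \esum_(o in [set: T]) (m o)%:E * g o.

Let W0 k o : (0 <= W k o)%R. Proof. by case: chW. Qed.
Let m0 o : (0 <= m o)%R. Proof. exact: mix_ge0. Qed.
Let p0 k o : (0 <= p k o)%R. Proof. by rewrite divr_ge0. Qed.

Let mp k o : (m o * p k o = W k o)%R.
Proof.
rewrite /p; have [mz|mz] := eqVneq (m o) 0%R; last by rewrite mulrC divfK.
by rewrite mz mul0r (mix_eq0 pi_gt0 (W0^~ o) mz).
Qed.

Lemma disc_is_channel : is_channel mu p.
Proof.
split; [by move=> k; exact: disc_measurable_fun|split => // k].
rewrite (muE (g := fun y => (p k y)%:E)) => [|o]; last by rewrite lee_fin.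
have [_ W1] := chW; rewrite -[RHS](W1 k); apply: eq_esum => o _.
by rewrite -EFinM mp.
Qed.

(** The weight [m o] is absorbed by homogeneity of the perspective, which turns the densities back
    into [W]. *)
Lemma disc_cinfo : cinfo f pi mu p = dinfo f pi W.
Proof.
rewrite /dinfo esum_sum => [|o k _ _]; last first.
  by rewrite mule_ge0 ?lee_fin ?persp_ge0// ltW.
apply: eq_bigr => k _.
rewrite esumZl => [||o]; [|by rewrite lee_fin ltW|exact: persp_ge0].
congr (_ * _); rewrite (muE (g := fun y => persp f (p k y) (mix pi (p^~ y)))).
  apply: eq_esum => o _; rewrite -persp_scale// mp -mixZ; congr persp.
  by apply: eq_mix => j; rewrite mp.
by move=> o; exact: persp_ge0.
Qed.

Lemma iint_disc n (g : seq T -> \bar R) : (forall s, 0 <= g s) ->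
  iint mu n g = \esum_(t in [set: n.-tuple T]) (\prod_(o <- t) m o)%:E * g t.
Proof.
elim: n g => [|n IH] g g0.
  by rewrite esum_tuple0/= big_nil mul1e.
have mg0 k (t : k.-tuple T) s : 0 <= (\prod_(o <- t) m o)%:E * g s.
  by rewrite mule_ge0// lee_fin prodr_ge0.
rewrite /= (muE (g := fun y => iint mu n (fun ys => g (y :: ys)))); last first.
  by move=> o; rewrite IH//; apply: esum_ge0 => t _; exact: mg0.
rewrite esum_tupleS; last by move=> t; exact: mg0.
apply: eq_esum => o _; rewrite IH// -esumZl ?lee_fin//.
by apply: eq_esum => t _; rewrite big_cons EFinM muleA.
Qed.

Lemma disc_cinfo_comp r (B : 'I_q -> (r.-1).-tuple 'I_q -> R) :
  (forall k x, (0 <= B k x)%R) ->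
  cinfo_comp f pi B mu p = dinfo f pi (compchan B W).
Proof.
move=> B0.
have c0 k t : (0 <= compchan B W k t)%R.
  by apply: sumr_ge0 => x _; rewrite mulr_ge0// prodr_ge0.
have d0 k ys : (0 <= compdens B p k ys)%R.
  by apply: sumr_ge0 => x _; rewrite mulr_ge0// prodr_ge0.
rewrite /dinfo esum_sum => [|t k _ _]; last first.
  by rewrite mule_ge0 ?lee_fin ?persp_ge0// ltW.
apply: eq_bigr => k _.
rewrite esumZl => [||t]; [|by rewrite lee_fin ltW|exact: persp_ge0].
congr (_ * _); rewrite iint_disc => [|s]; last exact: persp_ge0.
have dE j (t : (r.-1).-tuple T) :
    (\prod_(o <- t) m o * compdens B p j t = compchan B W j t)%R.
  rewrite mulr_sumr; apply: eq_bigr => x _.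
  rewrite mulrCA prod_zip_tnth big_tuple -big_split/=; congr (_ * _)%R.
  by apply: eq_bigr => i _; rewrite mp.
apply: eq_esum => t _; rewrite -persp_scale ?prodr_ge0// dE.
rewrite -/(mix pi _) -mixZ; congr persp; apply: eq_mix => j; exact: dE.
Qed.

End Realization.

Section RealizationBMS.
Local Open Scope ereal_scope.
Local Open Scope classical_set_scope.

(** Under the uniform prior the marginal is invariant under [s], so the symmetry of [W] passes to
    the densities outcome by outcome. *)
Lemma disc_is_BMS (R : realType) (T : choiceType) (x0 : T) (W : 'I_2 -> T -> R)
    (mu : probability (disc x0) R) (s : T -> T) :
  dchannel W -> involutive s -> (forall k o, W k (s o) = W (flip2 k) o) ->
  (forall g : T -> \bar R, (forall o, 0 <= g o) ->
    (\int[mu]_(y in setT) g y =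
     \esum_(o in [set: T]) (mix (@unif2 R) (W^~ o))%:E * g o)%E) ->
  is_BMS mu (fun k (o : disc x0) => W k o / mix (@unif2 R) (W^~ o))%R.
Proof.
move=> [W0 _] sK Ws muE; exists s; split => [||k E mE].
- exact: disc_measurable_fun.
- exact: sK.
have m0 o : (0 <= mix (@unif2 R) (W^~ o))%R by exact: (mix_ge0 (@unif2_gt0 R)).
have ms o : mix (@unif2 R) (W^~ (s o)) = mix (@unif2 R) (W^~ o).
  by rewrite -[RHS]mix_flip2; apply: eq_mix => j; rewrite Ws.
have intE j (F : set T) : \int[mu]_(y in (F : set (disc x0)))
      (W j y / mix (@unif2 R) (W^~ y))%:E =
    \esum_(o in F) ((mix (@unif2 R) (W^~ o))%:E *
      (W j o / mix (@unif2 R) (W^~ o))%:E).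
  rewrite integral_mkcond (muE (((fun y => (W j y / mix (@unif2 R) (W^~ y))%:E) \_ F))).
    rewrite [RHS]esum_mkcond; apply: eq_esum => o _; rewrite patchE.
    by case: ifP; rewrite ?mule0.
  by move=> o; rewrite patchE; case: ifP => // _; rewrite lee_fin divr_ge0.
rewrite !intE (@esum_image R T T E s); last by move=> x y _ _; exact: (can_inj sK).
apply: (@eq_esum R T E) => o _; by rewrite ms Ws flip2K.
Qed.

End RealizationBMS.

(** * The broadcasting model *)

Section Eta.
Context {R : realType}.
Variable f : R -> \bar R.
Hypothesis fKL_le : forall t, 0 <= t -> (fKL t <= f t)%E.
Local Open Scope ereal_scope.
Local Open Scope classical_set_scope.

(** Supplies the base point of [disc]: an empty alphabet could not carry mass 1. *)
Lemma dchannel_point (q : nat) (k : 'I_q) (T : choiceType) (W : 'I_q -> T -> R) :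
  dchannel W -> exists x0 : T, True.
Proof.
move=> [_ /(_ k) W1]; apply/not_existsP => nT.
move: W1; rewrite esum1 => [/esym/eqP|o _]; first by rewrite onee_eq0.
by have := nT o.
Qed.

Lemma eta_m_ge (q r : nat) (pi : 'I_q -> R) (B : 'I_q -> (r.-1).-tuple 'I_q -> R)
    (T : choiceType) (h : T -> nat) (W : 'I_q -> T -> R) :
  is_pi pi -> is_B pi B -> injective h -> dchannel W ->
  0 < dinfo f pi W -> dinfo f pi W < +oo ->
  dinfo f pi (compchan B W) * (((r.-1)%:R * fine (dinfo f pi W))^-1)%:E <=
  eta_m f pi B.
Proof.
move=> [pi_gt0 pi1] [B0 B1 _] hinj chW I0 Ioo.
have q0 : (0 < q)%N.
  rewrite lt0n; apply/eqP => qz; move: pi1; rewrite big1 => [/esym/eqP|k _].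
    by rewrite oner_eq0.
  by have := ltn_ord k; rewrite {2}qz.
have [x0 _] := dchannel_point (Ordinal q0) chW.
have [W0 _] := chW.
have m0 o : (0 <= mix pi (W^~ o))%R by exact: (mix_ge0 pi_gt0).
have [mu muE] := disc_probability x0 hinj m0 (esum_mix pi_gt0 pi1 chW).
apply: ereal_sup_ubound.
exists default_measure_display, (disc x0), mu, (fun k o => W k o / mix pi (W^~ o))%R.
rewrite (disc_cinfo pi_gt0 fKL_le chW muE) (disc_cinfo_comp pi_gt0 fKL_le chW muE)//.
split => //; exact: (disc_is_channel pi_gt0 chW muE).
Qed.

Lemma eta_ms_ge (r : nat) (B : 'I_2 -> (r.-1).-tuple 'I_2 -> R)
    (T : choiceType) (h : T -> nat) (s : T -> T) (W : 'I_2 -> T -> R) :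
  is_B (@unif2 R) B -> injective h -> dchannel W ->
  involutive s -> (forall k o, W k (s o) = W (flip2 k) o) ->
  0 < dinfo f (@unif2 R) W -> dinfo f (@unif2 R) W < +oo ->
  dinfo f (@unif2 R) (compchan B W) *
    (((r.-1)%:R * fine (dinfo f (@unif2 R) W))^-1)%:E <= eta_ms f B.
Proof.
move=> [B0 B1 _] hinj chW sK Ws I0 Ioo.
have pi_gt0 := @unif2_gt0 R.
have [x0 _] := dchannel_point ord0 chW.
have [W0 _] := chW.
have m0 o : (0 <= mix (@unif2 R) (W^~ o))%R by exact: (mix_ge0 pi_gt0).
have [mu muE] := disc_probability x0 hinj m0 (esum_mix pi_gt0 (@unif2_sum1 R) chW).
apply: ereal_sup_ubound.
exists default_measure_display, (disc x0), mu,
  (fun k o => W k o / mix (@unif2 R) (W^~ o))%R.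
rewrite (disc_cinfo pi_gt0 fKL_le chW muE) (disc_cinfo_comp pi_gt0 fKL_le chW muE)//.
split => //; first exact: (disc_is_channel pi_gt0 chW muE).
exact: (disc_is_BMS chW sK Ws muE).
Qed.

End Eta.

(** Countability of the observations, as needed to put a probability measure on them. *)
Lemma obsT_injective (q r k : nat) :
  exists h : obsT q r k -> nat, injective h.
Proof.
elim: k => [|k [h hinj]]; first by exists val; exact: val_inj.
exists (fun es : seq ((r.-1).-tuple (obsT q r k)) =>
  pickle [seq map h (val e) | e <- es]).
move=> es1 es2 /(pcan_inj pickleK); apply: inj_map => e1 e2 /(inj_map hinj).
exact: val_inj.
Qed.

Fixpoint obs_flip (r k : nat) {struct k} : obsT 2 r k -> obsT 2 r k :=
  match k as k0 return obsT 2 r k0 -> obsT 2 r k0 with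
  | 0 => fun o : 'I_2 => flip2 o
  | k'.+1 => fun es : seq ((r.-1).-tuple (obsT 2 r k')) =>
      [seq map_tuple (@obs_flip r k') e | e <- es]
  end.

Lemma obs_flipK (r k : nat) : involutive (@obs_flip r k).
Proof.
elim: k => [|k IH]; first exact: flip2K.
apply: mapK => e; apply: eq_from_tnth => i.
by rewrite !tnth_map; exact: IH.
Qed.

Section Observations.
Context {R : realType} (q r : nat) (pi : 'I_q -> R).
Variables (B : 'I_q -> (r.-1).-tuple 'I_q -> R) (D : nat -> R) (dm : R).
Hypotheses (pi_pi : is_pi pi) (B_B : is_B pi B) (D_D : is_offspring D dm).
Local Open Scope ereal_scope.
Local Open Scope classical_set_scope.

Definition obschan (k : nat) (y : 'I_q) (o : obsT q r k) : R := obsP B D o y.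

Lemma obschanS k : @obschan k.+1 = forest D (compchan B (@obschan k)).
Proof. by []. Qed.

Lemma dchannel_obschan k : dchannel (@obschan k).
Proof.
have [B0 B1 _] := B_B; have [D0 D1 _] := D_D.
elim: k => [|k IH].
  split => [y o|y]; first by rewrite /obschan /= ler0n.
  rewrite (@esum_finType _ 'I_q (fun o => (o == y)%:R%:E))//.
  rewrite (bigD1 y)//= eqxx big1 ?adde0// => i /negPf ->//.
rewrite obschanS; apply: dchannel_forest => //; exact: dchannel_comp.
Qed.

(** At depth 0 the labels of the children are seen exactly. This is how finiteness of the SKL
    information of [B] enters at depth 1. *)
Lemma compchan_obschan0 : compchan B (@obschan 0) = B.
Proof.
apply/funext => k; apply/funext => e; rewrite /compchan (bigD1 e)//=.
rewrite [X in (_ * X)%R]big1 => [|i _]; last by rewrite /obschan /= eqxx.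
rewrite mulr1 big1 ?addr0// => x xe.
have [[i ie]|] := pselect (exists i, tnth e i != tnth x i).
  rewrite (bigD1 i)//= /obschan/= (negPf ie).
  by rewrite mul0r mulr0.
move=> /forallNP ne; case/eqP: xe; apply: eq_from_tnth => i.
by apply/esym/eqP/negPn/negP => /(ne i).
Qed.

(** * Geometric decay along the depth *)

Section Contraction.
Variable f : R -> \bar R.
Hypothesis f1 : f 1%R = 0.
Hypothesis fKL_le : forall t, (0 <= t)%R -> fKL t <= f t.
Hypothesis sub : forall k, subadditive pi f (compchan B (@obschan k)).
(** Kept abstract, with a bound only at the observation channels, so that the suprema over all
    channels and over BMS channels can both be substituted. *)
Variable eta : \bar R.
Hypothesis etaP : forall k, 0 < dinfo f pi (@obschan k) ->
  dinfo f pi (@obschan k) < +oo ->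
  dinfo f pi (compchan B (@obschan k)) *
    (((r.-1)%:R * fine (dinfo f pi (@obschan k)))^-1)%:E <= eta.
Hypothesis r1 : (1 < r)%N.
Hypothesis eta_lt1 : ((r.-1)%:R * dm)%:E * eta < 1.

Let dm0 : (0 <= dm)%R.
Proof.
have [D0 _ Dm] := D_D; rewrite -lee_fin -Dm; apply: nneseries_ge0 => n _ _.
by rewrite lee_fin mulr_ge0.
Qed.

Let I0 k : 0 <= dinfo f pi (@obschan k).
Proof. by have [? _] := dchannel_obschan k; apply: dinfo_ge0 => //; case: pi_pi. Qed.

Let E0 k : 0 <= dinfo f pi (compchan B (@obschan k)).
Proof.
have [B0 B1 _] := B_B; have [? _] := dchannel_comp B0 B1 (dchannel_obschan k).
by apply: dinfo_ge0 => //; case: pi_pi.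
Qed.

Lemma dinfo_obschanS k :
  dinfo f pi (@obschan k.+1) <= dm%:E * dinfo f pi (compchan B (@obschan k)).
Proof.
have [pi_gt0 pi1] := pi_pi; have [B0 B1 _] := B_B.
rewrite obschanS; apply: dinfo_forest_le => //.
exact: dchannel_comp (dchannel_obschan k).
Qed.

Lemma dinfo_obschan_contract : exists2 c : R, (0 <= c < 1)%R &
  forall k, dinfo f pi (@obschan k) < +oo ->
    dinfo f pi (@obschan k.+1) <= c%:E * dinfo f pi (@obschan k).
Proof.
have [pi_gt0 pi1] := pi_pi; have [B0 B1 _] := B_B.
have rp : (0 < (r.-1)%:R :> R)%R by rewrite ltr0n -subn1 subn_gt0.
have zero k : dinfo f pi (@obschan k) = 0 -> dinfo f pi (@obschan k.+1) <= 0.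
  have [W0 _] := dchannel_obschan k.
  move=> Ik; apply: le_trans (dinfo_obschanS k) _.
  by rewrite (dinfo_comp_eq0 pi_gt0 pi1 f1 fKL_le B1 W0 Ik) mule0.
(* For [dm = 0] the hypothesis allows [eta = +oo], as the product is then 0. *)
have [dz|dn] := eqVneq dm 0%R.
  exists 0%R => [|k _]; first by rewrite lexx ltr01.
  by rewrite mul0e (le_trans (dinfo_obschanS k))// dz mul0e.
have dp : (0 < dm)%R by rewrite lt_neqAle eq_sym dn.
(* Without a depth of positive finite information [eta] may be negative, even [-oo]; but then every
   finite information is already 0. With such a depth, [eta] is nonnegative. *)
have [[k0 [k0p k0oo]]|none] :=
    pselect (exists k, 0 < dinfo f pi (@obschan k) /\ dinfo f pi (@obschan k) < +oo); last first.
  exists 0%R => [|k Ik]; first by rewrite lexx ltr01.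
  rewrite mul0e zero//; apply/eqP; rewrite eq_le I0 andbT leNgt.
  by apply/negP => Ip; apply: none; exists k.
have eta0 : 0 <= eta.
  apply: le_trans (etaP k0p k0oo); rewrite mule_ge0// lee_fin invr_ge0.
  by rewrite mulr_ge0 ?fine_ge0// ltW.
have etaoo : eta != +oo.
  apply: contraTneq eta_lt1 => ->.
  by rewrite gt0_muley ?lte_fin ?mulr_gt0// -leNgt leey.
move: eta0 etaoo etaP eta_lt1; case: eta => [e||]//; rewrite lee_fin => e0 _ eP.
rewrite -EFinM lte_fin => c1.
exists ((r.-1)%:R * dm * e)%R => [|k Ik]; first by rewrite c1 !mulr_ge0// ltW.
have [Iz|In] := eqVneq (dinfo f pi (@obschan k)) 0.
  by rewrite Iz mule0 zero.
have Ip : 0 < dinfo f pi (@obschan k) by rewrite lt_neqAle eq_sym In I0.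
have Ifin : dinfo f pi (@obschan k) \is a fin_num.
  by rewrite ge0_fin_numE.
have fp : (0 < fine (dinfo f pi (@obschan k)))%R by rewrite fine_gt0// Ip.
have := eP k Ip Ik; rewrite lee_pdivrMr ?mulr_gt0// => le.
apply: le_trans (dinfo_obschanS k) _.
apply: le_trans (lee_wpmul2l _ le) _; first by rewrite lee_fin.
rewrite -[in leRHS](fineK Ifin) -!EFinM lee_fin.
by rewrite le_eqVlt; apply/orP; left; apply/eqP; ring.
Qed.

(** The decay starts at a chosen depth [k0], since a generator may be infinite when the root label
    is revealed; a shift of the index does not affect the limit. *)
Lemma dinfo_obschan_impossible k0 : dinfo f pi (@obschan k0) < +oo ->
  reconstruction_impossible pi B D.
Proof.
move=> k0oo.
have [c /andP[c0 c1] contract] := dinfo_obschan_contract.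
have Ifin : dinfo f pi (@obschan k0) \is a fin_num by rewrite ge0_fin_numE.
pose x := fine (dinfo f pi (@obschan k0)).
have bound n : dinfo f pi (@obschan (n + k0)) <= (geometric x c n)%:E.
  elim: n => [|n IH]; first by rewrite /geometric /= expr0 mulr1 fineK.
  rewrite addSn (le_trans (contract _ _))//; first by rewrite (le_lt_trans IH)// ltry.
  apply: le_trans (lee_wpmul2l _ IH) _; first by rewrite lee_fin.
  by rewrite -EFinM lee_fin /geometric /= exprS mulrCA.
have W0 k y o : (0 <= @obschan k y o)%R by have [] := dchannel_obschan k.
have [pi_gt0 _] := pi_pi.
rewrite /reconstruction_impossible.
rewrite -(cvg_shiftn k0 (fun k => MI_k pi B D k)).
apply: (@squeeze_cvge _ _ _ _ (fun=> 0) _ (fun n : nat => (geometric x c n)%:E) _ 0).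
- apply: nearW => n; apply/andP; split.
    by apply: (dinfo_ge0 pi_gt0 (fun _ _ => lexx _)) => y o; exact: W0.
  apply: le_trans (bound n); apply: le_esum => o _; apply: lee_sum => y _.
  by rewrite lee_wpmul2l ?lee_fin ?(ltW (pi_gt0 y))// le_persp// W0.
- exact: cvg_cst.
- apply: cvg_EFin; first exact: nearW.
  by apply: cvg_geometric; rewrite ger0_norm.
Qed.

End Contraction.
End Observations.

(** * The criteria for KL and SKL *)

Section Criteria.
Context {R : realType} (q r : nat) (pi : 'I_q -> R).
Variables (B : 'I_q -> (r.-1).-tuple 'I_q -> R) (D : nat -> R) (dm : R).
Hypotheses (pi_pi : is_pi pi) (B_B : is_B pi B) (D_D : is_offspring D dm).
Hypothesis r1 : (1 < r)%N.
Local Open Scope ereal_scope.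
Local Open Scope classical_set_scope.

Let chE k : dchannel (compchan B (@obschan R q r B D k)).
Proof.
have [B0 B1 _] := B_B; exact: dchannel_comp B0 B1 (dchannel_obschan B_B D_D k).
Qed.

Lemma dinfo_obschan0_lt (f : R -> \bar R) : (forall t, (0 <= t)%R -> fKL t <= f t) ->
  (forall a : 'I_q -> R, (forall k, (0 <= a k)%R) -> Jinfo f pi a < +oo) ->
  dinfo f pi (@obschan R q r B D 0) < +oo.
Proof.
move=> fKL_le Joo; have [pi_gt0 _] := pi_pi.
have [W0 _] := dchannel_obschan B_B D_D 0.
rewrite /dinfo (@esum_finType R 'I_q (fun o => Jinfo f pi ((@obschan R q r B D 0)^~ o))).
  by apply: lte_sum_pinfty => o _; apply: Joo => k; exact: W0.
by move=> o; exact: (Jinfo_ge0 pi_gt0 fKL_le (W0^~ o)).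
Qed.

Lemma KL_impossible (eta : \bar R) :
  (forall k, 0 < dinfo (@fKL R) pi (@obschan R q r B D k) ->
    dinfo (@fKL R) pi (@obschan R q r B D k) < +oo ->
    dinfo (@fKL R) pi (compchan B (@obschan R q r B D k)) *
      (((r.-1)%:R * fine (dinfo (@fKL R) pi (@obschan R q r B D k)))^-1)%:E <= eta) ->
  ((r.-1)%:R * dm)%:E * eta < 1 -> reconstruction_impossible pi B D.
Proof.
move=> etaP eta1; have [pi_gt0 pi1] := pi_pi.
have f1 : @fKL R 1 = 0 by rewrite fKL_kl /kl divff// ln1 mul1r add0r addNr.
have subE k : subadditive pi (@fKL R) (compchan B (@obschan R q r B D k)).
  by move=> T V; exact: dinfo_KL_prod.
apply: (dinfo_obschan_impossible pi_pi B_B D_D f1 (fun _ _ => lexx _)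
  subE etaP r1 eta1 (k0 := 0%N)).
apply: dinfo_obschan0_lt => // a a0.
by rewrite (Jinfo_KL pi_gt0 a0) ltry.
Qed.

Lemma SKL_impossible (eta : \bar R) :
  (forall k, 0 < dinfo (@fSKL R) pi (@obschan R q r B D k) ->
    dinfo (@fSKL R) pi (@obschan R q r B D k) < +oo ->
    dinfo (@fSKL R) pi (compchan B (@obschan R q r B D k)) *
      (((r.-1)%:R * fine (dinfo (@fSKL R) pi (@obschan R q r B D k)))^-1)%:E <= eta) ->
  ((r.-1)%:R * dm)%:E * eta < 1 -> dinfo (@fSKL R) pi B < +oo ->
  reconstruction_impossible pi B D.
Proof.
move=> etaP eta1 Boo; have [pi_gt0 pi1] := pi_pi.
have f1 : @fSKL R 1 = 0 by rewrite /fSKL oner_eq0 subrr mul0r.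
have subE k : subadditive pi (@fSKL R) (compchan B (@obschan R q r B D k)).
  by move=> T V; exact: dinfo_SKL_prod.
(* [I_SKL] is infinite at depth 0, where the label of the root is revealed *)
apply: (dinfo_obschan_impossible pi_pi B_B D_D f1 (@fKL_le_fSKL R)
  subE etaP r1 eta1 (k0 := 1%N)).
apply: le_lt_trans (dinfo_obschanS pi_pi B_B D_D f1 (@fKL_le_fSKL R) subE 0) _.
rewrite (_ : dinfo _ _ _ = dinfo (@fSKL R) pi B); last first.
  by apply: congr1; exact: compchan_obschan0.
have B0 : 0 <= dinfo (@fSKL R) pi B.
  by have [? _ _] := B_B; apply: dinfo_ge0 => //; exact: fKL_le_fSKL.
have Bfin : dinfo (@fSKL R) pi B \is a fin_num by rewrite ge0_fin_numE.
by rewrite -(fineK Bfin) -EFinM ltry.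
Qed.

End Criteria.

(** * Flip symmetry and the chi-square criterion *)

Section BinarySymmetric.
Context {R : realType} (r : nat).
Variables (B : 'I_2 -> (r.-1).-tuple 'I_2 -> R) (D : nat -> R) (dm : R).
Hypothesis B_B : is_B (@unif2 R) B.
Hypothesis D_D : is_offspring D dm.
Hypothesis Bsym : forall k x, B k x = B (flip2 k) (map_tuple flip2 x).
Hypothesis r1 : (1 < r)%N.
Local Open Scope ereal_scope.
Local Open Scope classical_set_scope.

(** Flipping the leaf labels keeps the shape of the tree, hence the factor [D], and at each level
    [compchan_flip2] carries the flip across one generation of hyperedges. *)
Lemma obschan_flip k y (o : obsT 2 r k) :
  obschan B D y (obs_flip o) = obschan B D (flip2 y) o.
Proof.
elim: k y o => [|k IH] y o.
  by rewrite /obschan /= (can2_eq flip2K flip2K).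
rewrite !obschanS /forest size_map big_map; congr (_ * _)%R.
by apply: eq_bigr => e _; apply: compchan_flip2.
Qed.

Lemma chi2_impossible (eta : \bar R) :
  (forall k, 0 < dinfo (@fchi2 R) (@unif2 R) (@obschan R 2 r B D k) ->
    dinfo (@fchi2 R) (@unif2 R) (@obschan R 2 r B D k) < +oo ->
    dinfo (@fchi2 R) (@unif2 R) (compchan B (@obschan R 2 r B D k)) *
      (((r.-1)%:R * fine (dinfo (@fchi2 R) (@unif2 R) (@obschan R 2 r B D k)))^-1)%:E
      <= eta) ->
  ((r.-1)%:R * dm)%:E * eta < 1 -> reconstruction_impossible (@unif2 R) B D.
Proof.
move=> etaP eta1.
have pi_pi : is_pi (@unif2 R) by split; [exact: unif2_gt0|exact: unif2_sum1].
have f1 : @fchi2 R 1 = 0 by rewrite /fchi2 subrr expr0n.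
have [B0 B1 _] := B_B.
have subE k : subadditive (@unif2 R) (@fchi2 R) (compchan B (@obschan R 2 r B D k)).
  move=> T V chV.
  apply: (@dinfo_chi2_prod _ _ _ (map_tuple (@obs_flip r k))) => //.
  - by move=> e; apply: eq_from_tnth => i; rewrite !tnth_map obs_flipK.
  - by move=> y e; apply: compchan_flip2 => // j o; exact: obschan_flip.
  - exact: dchannel_comp B0 B1 (dchannel_obschan B_B D_D k).
apply: (dinfo_obschan_impossible pi_pi B_B D_D f1 (@fKL_le_fchi2 R)
  subE etaP r1 eta1 (k0 := 0%N)).
apply: (dinfo_obschan0_lt pi_pi B_B D_D (@fKL_le_fchi2 R)) => a a0.
by rewrite (Jinfo_chi2 a0) ltry.
Qed.

End BinarySymmetric.

Theorem theorem1 :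
  (* (i) general model BOHT(q, r, pi, B, D), E_{t ~ D} t = dm *)
  (forall (R : realType) (q r : nat) (pi : 'I_q -> R)
     (B : 'I_q -> (r.-1).-tuple 'I_q -> R) (D : nat -> R) (dm : R),
     (1 < q)%N -> (1 < r)%N ->
     is_pi pi -> is_B pi B -> is_offspring D dm ->
     ((((r.-1)%:R * dm)%:E * eta_m (@fKL R) pi B < 1)%E
      \/ ((((r.-1)%:R * dm)%:E * eta_m (@fSKL R) pi B < 1)%E /\
          (dinfo (@fSKL R) pi B < +oo)%E)) ->
     reconstruction_impossible pi B D)
  /\
  (* (ii) binary symmetric model BOHT(2, r, Unif, B, D) *)
  (forall (R : realType) (r : nat) (pi : 'I_2 -> R)
     (B : 'I_2 -> (r.-1).-tuple 'I_2 -> R) (D : nat -> R) (dm : R),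
     (1 < r)%N ->
     is_pi pi -> is_B pi B -> is_offspring D dm ->
     is_binary_symmetric pi B ->
     ((((r.-1)%:R * dm)%:E * eta_ms (@fKL R) B < 1)%E
      \/ (((r.-1)%:R * dm)%:E * eta_ms (@fchi2 R) B < 1)%E
      \/ ((((r.-1)%:R * dm)%:E * eta_ms (@fSKL R) B < 1)%E /\
          (dinfo (@fSKL R) (@unif2 R) B < +oo)%E)) ->
     reconstruction_impossible pi B D).
Proof.
split.
  move=> R q r pi B D dm _ r1 pi_pi B_B D_D.
  have chP := dchannel_obschan B_B D_D.
  have injP k := obsT_injective q r k.
  case=> [eta1|[eta1 Boo]].
    apply: (KL_impossible pi_pi B_B D_D r1 _ eta1) => k; have [h hinj] := injP k.
    exact: (eta_m_ge (fun _ _ => lexx _) pi_pi B_B hinj (chP k)).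
  apply: (SKL_impossible pi_pi B_B D_D r1 _ eta1 Boo) => k; have [h hinj] := injP k.
  exact: (eta_m_ge (@fKL_le_fSKL R) pi_pi B_B hinj (chP k)).
move=> R r pi B D dm r1 pi_pi B_B D_D [pi_unif Bsym].
have piE : pi = @unif2 R by apply/funext => k; rewrite pi_unif.
rewrite piE in pi_pi B_B *.
have chP := dchannel_obschan B_B D_D.
have flipP k := @obschan_flip R r B D Bsym k.
have injP k := obsT_injective 2 r k.
case=> [eta1|[eta1|[eta1 Boo]]].
- apply: (KL_impossible pi_pi B_B D_D r1 _ eta1) => k; have [h hinj] := injP k.
  exact: (eta_ms_ge (fun _ _ => lexx _) B_B hinj (chP k) (@obs_flipK r k) (@flipP k)).
- apply: (chi2_impossible B_B D_D Bsym r1 _ eta1) => k; have [h hinj] := injP k.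
  exact: (eta_ms_ge (@fKL_le_fchi2 R) B_B hinj (chP k) (@obs_flipK r k) (@flipP k)).
- apply: (SKL_impossible pi_pi B_B D_D r1 _ eta1 Boo) => k; have [h hinj] := injP k.
  exact: (eta_ms_ge (@fKL_le_fSKL R) B_B hinj (chP k) (@obs_flipK r k) (@flipP k)).
Qed.
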